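(* Let $C=\bigoplus_{i\geq 0}C_i$ be a non-negatively graded commutative $k$-algebra, so that $C_0$ is a subalgebra of $C$. The inclusion $\iota: C_0\to C$ induces, via push-forward, a bijection $$\mathcal{P}_H(C_0)\cong\mathcal{P}_H(C).$$
   Context: Fix a field $k$. All algebras are associative unital $k$-algebras, algebra morphisms preserve units, and $\otimes$ without subscript means $\otimes_k$. $H$ is a Hopf algebra over $k$ with coproduct $\Delta$, counit $\varepsilon$ and bijective antipode. An $H$-comodule algebra is an algebra $A$ with a right $H$-comodule structure whose coaction $\Delta_A: A\to A\otimes H$ is a morphism of algebras. Its base is the subalgebra of coinvariants $A^{\mathrm{co}\,H}=\{a\in A : \Delta_A(a)=a\otimes 1_H\}$; if $C=A^{\mathrm{co}\,H}$ one says that $C\subset A$ is an $H$-extension. It is Galois if the map $A\otimes_C A\to A\otimes H$, $a\otimes b\mapsto (a\otimes 1_H)\Delta_A(b)$, is bijective. For a commutative algebra $C$, a quantum principal $H$-bundle over (with base) $C$ is a Galois $H$-extension $C\subset A$ such that $C$ is central in $A$ and $A$ is faithfully flat as a $C$-module. Two such bundles are isomorphic ($\cong$) if there is an isomorphism of $H$-comodule algebras between them. For a morphism $f:C\to C'$ of commutative algebras, the push-forward of a quantum principal $H$-bundle $A$ over $C$ is $f_*A=C'\otimes_C A$ with multiplication $(c_1'\otimes a_1)(c_2'\otimes a_2)=c_1'c_2'\otimes a_1a_2$ and coaction $\mathrm{id}_{C'}\otimes_C\Delta_A$; it is a quantum principal $H$-bundle over $C'$. For a commutative algebra $K$, let $[0],[1]:K[t]\to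 K$ be the $K$-algebra morphisms sending $t$ to $0$ and $1$ respectively. Let $\mathcal{C}_{\text{ét}}$ be the class of finite étale morphisms of commutative algebras. For two quantum principal $H$-bundles $A,A'$ over $C$, write $A\sim A'$ if there exist a morphism $i:C\to\bar C$ in $\mathcal{C}_{\text{ét}}$ and a quantum principal $H$-bundle $B$ with base $\bar C[t]$ such that $[0]_*B\cong i_*A$ and $[1]_*B\cong i_*A'$. Homotopy equivalence of quantum principal $H$-bundles over $C$ is the equivalence relation generated by $\sim$. $\mathcal{P}_H(C)$ denotes the set of homotopy equivalence classes of quantum principal $H$-bundles over $C$. Push-forward along a morphism $f:C\to C'$ preserves homotopy equivalence and so induces a map $f_*:\mathcal{P}_H(C)\to\mathcal{P}_H(C')$. *)

(* Defs.v *)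
From HB Require Import structures.
From Stdlib Require Import Relation_Operators.
From mathcomp Require Import all_boot all_algebra generic_quotient.
From mathcomp Require Import boolp.

Set Implicit Arguments.
Unset Strict Implicit.
Unset Printing Implicit Defensive.

Import GRing.Theory.
Local Open Scope ring_scope.
Local Open Scope quotient_scope.

Section TensorProduct.
Variables (R : comPzRingType) (M N : lmodType R).

(* A sequence of pairs stands for the sum of the pure tensors of its members;
   opposites need no sign, since - (m ⊗ n) = (- m) ⊗ n. *)
Inductive tens_rel : seq (M * N) -> seq (M * N) -> Prop :=
| tens_refl s : tens_rel s s
| tens_sym s t : tens_rel s t -> tens_rel t s
| tens_trans s t u : tens_rel s t -> tens_rel t u -> tens_rel s u
| tens_cat s s' t t' :
    tens_rel s s' -> tens_rel t t' -> tens_rel (s ++ t) (s' ++ t')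
| tens_comm s t : tens_rel (s ++ t) (t ++ s)
| tens_zero n : tens_rel [:: (0, n)] [::]
| tens_addl m m' n : tens_rel [:: (m + m', n)] [:: (m, n); (m', n)]
| tens_addr m n n' : tens_rel [:: (m, n + n')] [:: (m, n); (m, n')]
| tens_bal a m n : tens_rel [:: (a *: m, n)] [:: (m, a *: n)].

Definition tens_eqb (s t : seq (M * N)) : bool := `[< tens_rel s t >].

Fact tens_eqb_refl : reflexive tens_eqb.
Proof. by move=> s; apply/asboolP/tens_refl. Qed.
Fact tens_eqb_sym : symmetric tens_eqb.
Proof. by move=> s t; apply/asboolP/asboolP => /tens_sym. Qed.
Fact tens_eqb_trans : transitive tens_eqb.
Proof.
by move=> t s u /asboolP st /asboolP tu; apply/asboolP/(tens_trans st tu).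
Qed.

Canonical tens_equiv := EquivRel tens_eqb tens_eqb_refl tens_eqb_sym tens_eqb_trans.

Definition tensor : Type := {eq_quot tens_equiv}.
HB.instance Definition _ := Choice.on tensor.
HB.instance Definition _ := Quotient.on tensor.

Lemma tensP (s t : seq (M * N)) :
  tens_rel s t <-> \pi_tensor s = \pi_tensor t.
Proof.
split=> [st|e]; first by apply/eqmodP/asboolP.
by apply/asboolP; move: e => /eqmodP.
Qed.

Lemma tens_surj (x : tensor) : exists s, x = \pi_tensor s.
Proof. by exists (repr x); rewrite reprK. Qed.

Definition pure (m : M) (n : N) : tensor := \pi_tensor [:: (m, n)].

Definition tens_add (x y : tensor) : tensor := \pi_tensor (repr x ++ repr y).
Definition tens_scale (a : R) (x : tensor) : tensor :=
  \pi_tensor [seq (a *: p.1, p.2) | p <- repr x].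

Lemma tens_addE s t : tens_add (\pi_tensor s) (\pi_tensor t) = \pi_tensor (s ++ t).
Proof. by apply/tensP/tens_cat; apply/tensP; rewrite reprK. Qed.

Lemma tens_rel_scale a s t : tens_rel s t ->
  tens_rel [seq (a *: p.1, p.2) | p <- s] [seq (a *: p.1, p.2) | p <- t].
Proof.
elim=> {s t} [s|s t _|s t u _ st _|s s' t t' _ ss' _|s t|n|m m' n|m n n'|b m n] //=.
- exact: tens_refl.
- exact: tens_sym.
- exact: tens_trans.
- by rewrite !map_cat; apply: tens_cat.
- by rewrite !map_cat; apply: tens_comm.
- by rewrite scaler0; apply: tens_zero.
- by rewrite scalerDr; apply: tens_addl.
- exact: tens_addr.
- by rewrite scalerA mulrC -scalerA; apply: tens_bal.
Qed.

Lemma tens_scaleE a s :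
  tens_scale a (\pi_tensor s) = \pi_tensor [seq (a *: p.1, p.2) | p <- s].
Proof. by apply/tensP/tens_rel_scale/tensP; rewrite reprK. Qed.

Fact tens_addA : associative tens_add.
Proof.
move=> x y z; have [s ->] := tens_surj x; have [t ->] := tens_surj y; have [u ->] := tens_surj z.
by rewrite !tens_addE catA.
Qed.
Fact tens_addC : commutative tens_add.
Proof.
move=> x y; have [s ->] := tens_surj x; have [t ->] := tens_surj y; rewrite !tens_addE.
exact/tensP/tens_comm.
Qed.
Fact tens_add0 : left_id (\pi_tensor [::]) tens_add.
Proof. by move=> x; have [s ->] := tens_surj x; rewrite tens_addE. Qed.
Fact tens_addN : left_inverse (\pi_tensor [::]) (tens_scale (-1)) tens_add.
Proof.
move=> x; have [s ->] := tens_surj x; rewrite tens_scaleE tens_addE; apply/tensP.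
elim: s => [|[m n] s IH] /=; first exact: tens_refl.
rewrite scaleN1r; set s' := map _ s in IH *.
have := tens_cat (tens_cat (tens_refl [:: (- m, n)]) (tens_comm s' [:: (m, n)]))
  (tens_refl s).
rewrite -!catA /= => st; apply: tens_trans st _.
have: tens_rel [:: (- m, n); (m, n)] [::].
  apply: tens_trans (tens_sym (tens_addl _ _ _)) _.
  by rewrite addNr; apply: tens_zero.
by move=> e; exact: tens_cat e IH.
Qed.

HB.instance Definition _ :=
  GRing.isZmodule.Build tensor tens_addA tens_addC tens_add0 tens_addN.

Fact tens_scaleA a b x : tens_scale a (tens_scale b x) = tens_scale (a * b) x.
Proof.
have [s ->] := tens_surj x; rewrite !tens_scaleE -map_comp.
congr (\pi_tensor _); apply: eq_map => p /=; by rewrite scalerA.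
Qed.
Fact tens_scale1 : left_id 1 tens_scale.
Proof.
move=> x; have [s ->] := tens_surj x; rewrite tens_scaleE; congr (\pi_tensor _).
by rewrite -[RHS]map_id; apply: eq_map => -[m n] /=; rewrite scale1r.
Qed.
Fact tens_scaleDr : right_distributive tens_scale +%R.
Proof.
move=> a x y; have [s ->] := tens_surj x; have [t ->] := tens_surj y.
by rewrite [X in tens_scale _ X]tens_addE !tens_scaleE [RHS]tens_addE map_cat.
Qed.
Fact tens_scaleDl x : {morph tens_scale^~ x : a b / a + b}.
Proof.
move=> a b; have [s ->] := tens_surj x.
elim: s => [|[m n] s IH].
  by rewrite !tens_scaleE [RHS]tens_addE.
have sc c : tens_scale c (\pi_tensor ((m, n) :: s)) =
    \pi_tensor [:: (c *: m, n)] + tens_scale c (\pi_tensor s).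
  by rewrite !tens_scaleE [RHS]tens_addE.
rewrite !sc IH addrACA; congr (_ + _).
rewrite [RHS]tens_addE scalerDl; exact/tensP/tens_addl.
Qed.

HB.instance Definition _ := GRing.Zmodule_isLmodule.Build R tensor
  tens_scaleA tens_scale1 tens_scaleDr tens_scaleDl.

(* The additive map out of the tensor product induced by phi; it depends on the
   chosen representatives unless phi is biadditive and balanced (see tliftE),
   which is the case in every use below. *)
Definition tlift (V : zmodType) (phi : M -> N -> V) (x : tensor) : V :=
  \sum_(p <- repr x) phi p.1 p.2.

Definition balanced (V : zmodType) (phi : M -> N -> V) : Prop :=
  [/\ forall m m' n, phi (m + m') n = phi m n + phi m' n,
      forall m n n', phi m (n + n') = phi m n + phi m n' &
      forall a m n, phi (a *: m) n = phi m (a *: n)].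

Lemma tens_ind (P : tensor -> Prop) :
  P 0 -> (forall x y, P x -> P y -> P (x + y)) -> (forall m n, P (pure m n)) ->
  forall x, P x.
Proof.
move=> P0 PD Pp x; have [s ->] := tens_surj x; elim: s => [|[m n] s IH] //.
by have := PD _ _ (Pp m n) IH; rewrite [_ + _]tens_addE.
Qed.

Lemma tlift_pi (V : zmodType) (phi : M -> N -> V) s : balanced phi ->
  tlift phi (\pi_tensor s) = \sum_(p <- s) phi p.1 p.2.
Proof.
case=> Dl Dr Z; rewrite /tlift.
suff eq_sum u t : tens_rel u t ->
    \sum_(p <- u) phi p.1 p.2 = \sum_(p <- t) phi p.1 p.2.
  by apply/eq_sum/tensP; rewrite reprK.
elim=> {s u t} [s|s t _|s t u _ -> _|s s' t t' _ IH _ IH'|s t|n|m m' n|m n n'|b m n] //=.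
- by rewrite !big_cat IH IH'.
- by rewrite !big_cat /= addrC.
- rewrite big_cons !big_nil addr0 /=.
  by apply: (addrI (phi 0 n)); rewrite -Dl !addr0.
- by rewrite !big_cons !big_nil !addr0 Dl.
- by rewrite !big_cons !big_nil !addr0 Dr.
- by rewrite !big_cons !big_nil !addr0 Z.
Qed.

Lemma tliftE (V : zmodType) (phi : M -> N -> V) m n : balanced phi ->
  tlift phi (pure m n) = phi m n.
Proof. by move=> bal; rewrite tlift_pi // big_seq1. Qed.

Lemma tliftD (V : zmodType) (phi : M -> N -> V) x y : balanced phi ->
  tlift phi (x + y) = tlift phi x + tlift phi y.
Proof.
move=> bal; have [s ->] := tens_surj x; have [t ->] := tens_surj y; rewrite [_ + _ in LHS]tens_addE.
by rewrite !tlift_pi // big_cat.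
Qed.

Lemma tlift0 (V : zmodType) (phi : M -> N -> V) : balanced phi ->
  tlift phi 0 = 0.
Proof. by move=> bal; rewrite tlift_pi // big_nil. Qed.

Lemma pureDl m m' n : pure (m + m') n = pure m n + pure m' n.
Proof. by rewrite [RHS]tens_addE; apply/tensP/tens_addl. Qed.
Lemma pureDr m n n' : pure m (n + n') = pure m n + pure m n'.
Proof. by rewrite [RHS]tens_addE; apply/tensP/tens_addr. Qed.
Lemma pureZ a m n : pure (a *: m) n = pure m (a *: n).
Proof. exact/tensP/tens_bal. Qed.
Lemma pureZl a m n : a *: pure m n = pure (a *: m) n.
Proof. exact: tens_scaleE. Qed.

Lemma pure_balanced : balanced pure.
Proof. by split; [apply: pureDl | apply: pureDr | apply: pureZ]. Qed.

End TensorProduct.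

Notation "M ⊗ N" := (tensor M%type N%type) (at level 40, left associativity) : type_scope.
Notation "m ⊗ n" := (pure m n) (at level 40, left associativity) : ring_scope.

Definition tmap (R : comPzRingType) (M M' N N' : lmodType R)
    (u : M -> M') (v : N -> N') : M ⊗ N -> M' ⊗ N' :=
  tlift (fun m n => u m ⊗ v n).

Definition tassoc (R : comPzRingType) (M N P : lmodType R) :
    (M ⊗ N) ⊗ P -> M ⊗ (N ⊗ P) :=
  tlift (fun x p => tlift (fun m n => m ⊗ (n ⊗ p)) x).

Section TensorMaps.
Variable R : comPzRingType.

Lemma pure0 (M N : lmodType R) (n : N) : (0 : M) ⊗ n = 0.
Proof. by rewrite -(scale0r (0 : M)) -pureZl scale0r. Qed.

Lemma balanced_comp (M N : lmodType R) (V W : zmodType) (f : V -> W)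
    (phi : M -> N -> V) :
  {morph f : x y / x + y} -> balanced phi -> balanced (fun m n => f (phi m n)).
Proof.
by move=> fD [Dl Dr Z]; split=> *; rewrite ?(Dl, Dr, Z) ?fD.
Qed.

Lemma tlift_eq (M N : lmodType R) (V : zmodType) (f : M ⊗ N -> V) phi :
  balanced phi -> {morph f : x y / x + y} ->
  (forall m n, f (m ⊗ n) = phi m n) -> f =1 tlift phi.
Proof.
move=> bal fD fp; apply: tens_ind => [|x y IHx IHy|m n].
- rewrite tlift0 //; apply: (addrI (f 0)).
  by rewrite -fD !addr0.
- by rewrite fD tliftD // IHx IHy.
- by rewrite fp tliftE.
Qed.

Section Map.
Variables (M M' N N' : lmodType R) (u : M -> M') (v : N -> N').
Hypotheses (ul : linear u) (vl : linear v).

Lemma linD (X Y : lmodType R) (f : X -> Y) : linear f ->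
  {morph f : x y / x + y}.
Proof. by move=> lf x y; have := lf 1 x y; rewrite !scale1r. Qed.
Lemma linZ (X Y : lmodType R) (f : X -> Y) : linear f ->
  forall a, {morph f : x / a *: x}.
Proof.
move=> lf a x; have f0 : f 0 = 0.
  by apply: (addrI (f 0)); rewrite -(linD lf) !addr0.
by have := lf a x 0; rewrite f0 !addr0.
Qed.

Lemma tmap_balanced : balanced (fun m n => u m ⊗ v n).
Proof.
split=> *; rewrite ?(linD ul) ?(linD vl) ?pureDl ?pureDr //.
by rewrite (linZ ul) (linZ vl) pureZ.
Qed.
Lemma tmapE m n : tmap u v (m ⊗ n) = u m ⊗ v n.
Proof. exact: tliftE tmap_balanced. Qed.
Lemma tmapD : {morph tmap u v : x y / x + y}.
Proof. by move=> x y; apply: tliftD tmap_balanced. Qed.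
Lemma tmap0 : tmap u v 0 = 0.
Proof. exact: tlift0 tmap_balanced. Qed.
Lemma tmap_lin : linear (tmap u v).
Proof.
move=> a x y; rewrite tmapD; congr (_ + _).
elim/tens_ind: x => [|x x' IH IH'|m n].
- by rewrite scaler0 tmap0 scaler0.
- by rewrite scalerDr !tmapD scalerDr IH IH'.
- by rewrite pureZl !tmapE (linZ ul) pureZl.
Qed.

End Map.

Section Assoc.
Variables (M N P : lmodType R).

Lemma tassoc_bal1 (p : P) : balanced (fun (m : M) (n : N) => m ⊗ (n ⊗ p)).
Proof.
by split=> *; rewrite ?pureDl ?pureDr // pureZ pureZl.
Qed.
Lemma tassoc_bal :
  balanced (fun (x : M ⊗ N) (p : P) => tlift (fun m n => m ⊗ (n ⊗ p)) x).
Proof.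
split=> [x y p|x p q|a x p].
- exact: tliftD (tassoc_bal1 p).
- elim/tens_ind: x => [|x y IH IH'|m n].
  + by rewrite !tlift0 ?addr0 //; apply: tassoc_bal1.
  + rewrite !tliftD; try exact: tassoc_bal1.
    by rewrite IH IH' addrACA.
  + rewrite !tliftE; try exact: tassoc_bal1.
    by rewrite !pureDr.
- elim/tens_ind: x => [|x y IH IH'|m n].
  + by rewrite scaler0 !tlift0 //; apply: tassoc_bal1.
  + rewrite scalerDr !tliftD; try exact: tassoc_bal1.
    by rewrite IH IH'.
  + rewrite pureZl !tliftE; try exact: tassoc_bal1.
    by rewrite pureZ pureZl pureZ.
Qed.
Lemma tassocE (m : M) (n : N) (p : P) : tassoc (m ⊗ n ⊗ p) = m ⊗ (n ⊗ p).
Proof. by rewrite /tassoc (tliftE _ _ tassoc_bal) (tliftE _ _ (tassoc_bal1 p)). Qed.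
Lemma tassocD : {morph @tassoc R M N P : x y / x + y}.
Proof. by move=> x y; apply: tliftD tassoc_bal. Qed.
Lemma tassoc0 : @tassoc R M N P 0 = 0.
Proof. exact: tlift0 tassoc_bal. Qed.
End Assoc.

End TensorMaps.

Section TensorAlgebra.
Variables (R : comPzRingType) (A B : algType R).
Implicit Types (a : A) (b : B) (x y z : A ⊗ B).

Definition tens_mul x y : A ⊗ B :=
  tlift (fun a b => tlift (fun a' b' => (a * a') ⊗ (b * b')) y) x.

Lemma tens_mul_bal1 a b : balanced (fun a' b' => (a * a') ⊗ (b * b')).
Proof.
split=> *; rewrite ?mulrDr ?pureDl ?pureDr //.
by rewrite -!scalerAr pureZ.
Qed.

Lemma tens_mul_bal y :
  balanced (fun a b => tlift (fun a' b' => (a * a') ⊗ (b * b')) y).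
Proof.
split=> [a1 a2 b|a b1 b2|c a b]; elim/tens_ind: y => [|y y' IH IH'|a' b'];
  rewrite ?tlift0 ?tliftD ?tliftE; try exact: tens_mul_bal1.
- by rewrite addr0.
- by rewrite IH IH' addrACA.
- by rewrite mulrDl pureDl.
- by rewrite addr0.
- by rewrite IH IH' addrACA.
- by rewrite mulrDl pureDr.
- by [].
- by rewrite IH IH'.
- by rewrite -!scalerAl pureZ.
Qed.

Lemma tens_mulE a b a' b' : tens_mul (a ⊗ b) (a' ⊗ b') = (a * a') ⊗ (b * b').
Proof.
by rewrite /tens_mul (tliftE _ _ (tens_mul_bal _)) (tliftE _ _ (tens_mul_bal1 _ _)).
Qed.

Fact tens_mulDl : left_distributive tens_mul +%R.
Proof. by move=> x y z; apply: tliftD (tens_mul_bal z). Qed.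
Fact tens_mul0l x : tens_mul 0 x = 0.
Proof. exact: tlift0 (tens_mul_bal x). Qed.
Fact tens_mulDr : right_distributive tens_mul +%R.
Proof.
move=> x y z; elim/tens_ind: x => [|x x' IH IH'|a b].
- by rewrite !tens_mul0l addr0.
- by rewrite !tens_mulDl IH IH' addrACA.
- rewrite /tens_mul !(tliftE _ _ (tens_mul_bal _)).
  exact: tliftD (tens_mul_bal1 a b).
Qed.
Fact tens_mul0r x : tens_mul x 0 = 0.
Proof. by apply: (addrI (tens_mul x 0)); rewrite -tens_mulDr !addr0. Qed.
Fact tens_mulA : associative tens_mul.
Proof.
move=> x y z; elim/tens_ind: x => [|x x' IH IH'|a b].
- by rewrite !tens_mul0l.
- by rewrite !tens_mulDl IH IH'.
elim/tens_ind: y => [|y y' IH IH'|a' b'].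
- by rewrite tens_mul0l tens_mul0r tens_mul0l.
- by rewrite tens_mulDr !tens_mulDl tens_mulDr IH IH'.
elim/tens_ind: z => [|z z' IH IH'|a'' b''].
- by rewrite !tens_mul0r.
- by rewrite !tens_mulDr IH IH'.
- by rewrite !tens_mulE !mulrA.
Qed.
Fact tens_mul1l : left_id (1 ⊗ 1) tens_mul.
Proof.
elim/tens_ind=> [|x y IH IH'|a b]; first exact: tens_mul0r.
  by rewrite tens_mulDr IH IH'.
by rewrite tens_mulE !mul1r.
Qed.
Fact tens_mul1r : right_id (1 ⊗ 1) tens_mul.
Proof.
elim/tens_ind=> [|x y IH IH'|a b]; first exact: tens_mul0l.
  by rewrite tens_mulDl IH IH'.
by rewrite tens_mulE !mulr1.
Qed.

HB.instance Definition _ := GRing.Zmodule_isPzRing.Build (tensor A B)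
  tens_mulA tens_mul1l tens_mul1r tens_mulDl tens_mulDr.

Lemma pureM a b a' b' : (a ⊗ b) * (a' ⊗ b') = (a * a') ⊗ (b * b').
Proof. exact: tens_mulE. Qed.

Lemma tens_scaleAl c x y : c *: (x * y) = (c *: x) * y.
Proof.
elim/tens_ind: x => [|x x' IH IH'|a b].
- by rewrite mul0r !scaler0 mul0r.
- by rewrite mulrDl !scalerDr mulrDl IH IH'.
elim/tens_ind: y => [|y y' IH IH'|a' b'].
- by rewrite !mulr0 scaler0.
- by rewrite !mulrDr scalerDr IH IH'.
- by rewrite pureM !pureZl pureM scalerAl.
Qed.
Lemma tens_scaleAr c x y : c *: (x * y) = x * (c *: y).
Proof.
elim/tens_ind: x => [|x x' IH IH'|a b].
- by rewrite !mul0r !scaler0.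
- by rewrite !mulrDl !scalerDr IH IH'.
elim/tens_ind: y => [|y y' IH IH'|a' b'].
- by rewrite !mulr0 scaler0 mulr0.
- by rewrite scalerDr !mulrDr scalerDr IH IH'.
- by rewrite pureM !pureZl pureM scalerAr.
Qed.

End TensorAlgebra.

(* The ring S as a left R-module, and as an R-algebra if S is commutative,
   through g : R -> S. *)
Definition along (R S : pzRingType) (g : {rmorphism R -> S}) : Type := S.

Section Along.
Variables (R S : pzRingType) (g : {rmorphism R -> S}).
HB.instance Definition _ := GRing.PzRing.on (along g).
Definition along_scale (r : R) (s : along g) : along g := g r * s.
Fact along_scaleA r r' s : along_scale r (along_scale r' s) = along_scale (r * r') s.
Proof. by rewrite /along_scale rmorphM mulrA. Qed.
Fact along_scale1 : left_id 1 along_scale.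
Proof. by move=> s; rewrite /along_scale rmorph1 mul1r. Qed.
Fact along_scaleDr : right_distributive along_scale +%R.
Proof. by move=> r s t; rewrite /along_scale mulrDr. Qed.
Fact along_scaleDl s : {morph along_scale^~ s : a b / a + b}.
Proof. by move=> a b; rewrite /along_scale rmorphD mulrDl. Qed.
HB.instance Definition _ := GRing.Zmodule_isLmodule.Build R (along g)
  along_scaleA along_scale1 along_scaleDr along_scaleDl.
End Along.

Section AlongAlg.
Variables (R : pzRingType) (S : comNzRingType) (g : {rmorphism R -> S}).
HB.instance Definition _ := GRing.ComNzRing.copy (along g) S.
Fact along_scaleAl (r : R) (s t : along g) : r *: (s * t) = (r *: s) * t.
Proof. exact: mulrA. Qed.
HB.instance Definition _ :=
  GRing.LSemiModule_isLSemiAlgebra.Build R (along g) along_scaleAl.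
Fact along_scaleAr (r : R) (s t : along g) : r *: (s * t) = s * (r *: t).
Proof. exact: mulrCA. Qed.
HB.instance Definition _ :=
  GRing.LSemiAlgebra_isSemiAlgebra.Build R (along g) along_scaleAr.
End AlongAlg.


Section Modules.

Definition exact_at (R : pzRingType) (L M N : lmodType R)
    (u : L -> M) (v : M -> N) : Prop :=
  forall y, v y = 0 <-> exists x, u x = y.

Definition faithfully_flat (R : comPzRingType) (P : lmodType R) : Prop :=
  forall (L M N : lmodType R) (u : {linear L -> M}) (v : {linear M -> N}),
    exact_at u v <->
    exact_at (tmap u id : L ⊗ P -> M ⊗ P) (tmap v id : M ⊗ P -> N ⊗ P).

Definition projective (R : pzRingType) (P : lmodType R) : Prop :=
  forall (M N : lmodType R) (g : {linear M -> N}) (h : {linear P -> N}),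
    (forall y, exists x, g x = y) ->
    exists l : {linear P -> M}, forall x, g (l x) = h x.

Definition finitely_generated (R : pzRingType) (P : lmodType R) : Prop :=
  exists (n : nat) (e : 'I_n -> P), forall x, exists c : 'I_n -> R,
    x = \sum_(i < n) c i *: e i.

End Modules.

Section Etale.

Section Mul.
Variables (R : comPzRingType) (B : comAlgType R).

Definition env_mul : B ⊗ B -> B := tlift (fun x y => x * y).

Lemma env_mul_bal : balanced (fun x y : B => x * y).
Proof. by split=> *; rewrite ?mulrDl ?mulrDr // -scalerAl scalerAr. Qed.
Lemma env_mulE x y : env_mul (x ⊗ y) = x * y.
Proof. exact: tliftE env_mul_bal. Qed.
Lemma env_mulD : {morph env_mul : x y / x + y}.
Proof. by move=> x y; apply: tliftD env_mul_bal. Qed.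
Lemma env_mul0 : env_mul 0 = 0.
Proof. exact: tlift0 env_mul_bal. Qed.
Lemma env_mulM : {morph env_mul : x y / x * y}.
Proof.
move=> x y; elim/tens_ind: x => [|x x' IH IH'|a b].
- by rewrite mul0r env_mul0 mul0r.
- by rewrite mulrDl !env_mulD mulrDl IH IH'.
elim/tens_ind: y => [|y y' IH IH'|a' b'].
- by rewrite mulr0 env_mul0 mulr0.
- by rewrite mulrDr !env_mulD mulrDr IH IH'.
- by rewrite pureM !env_mulE mulrACA.
Qed.
Lemma env_mul1 : env_mul 1 = 1.
Proof. by rewrite env_mulE mulr1. Qed.

HB.instance Definition _ :=
  GRing.isNmodMorphism.Build (tensor B B) B env_mul (env_mul0, env_mulD).
HB.instance Definition _ :=
  GRing.isMonoidMorphism.Build (tensor B B) B env_mul (env_mul1, env_mulM).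

(* Projectivity of B over its enveloping algebra, which for commutative B is
   B ⊗ B. *)
Definition separable : Prop := projective (along env_mul).
End Mul.

(* A finite étale algebra is a separable one whose underlying module is
   finitely generated projective; surjectivity on spectra is not required. *)
Definition finite_etale (C C' : comNzRingType) (f : {rmorphism C -> C'}) : Prop :=
  [/\ finitely_generated (along f), projective (along f) & separable (along f)].

End Etale.

Section PolynomialAlgebra.
Variables (k : fieldType) (C : comAlgType k).

(* {poly C} as a k-algebra; the library makes it an algebra over C only. *)
Definition kpoly : Type := {poly C}.
HB.instance Definition _ := GRing.ComNzRing.copy kpoly {poly C}.
Definition kpoly_scale (a : k) (p : kpoly) : kpoly := (a%:A : C) *: (p : {poly C}).
Fact kpoly_scaleA a b p : kpoly_scale a (kpoly_scale b p) = kpoly_scale (a * b) p.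
Proof. by rewrite /kpoly_scale scalerA -scalerAl mul1r scalerA. Qed.
Fact kpoly_scale1 : left_id 1 kpoly_scale.
Proof. by move=> p; rewrite /kpoly_scale !scale1r. Qed.
Fact kpoly_scaleDr : right_distributive kpoly_scale +%R.
Proof. by move=> a p q; rewrite /kpoly_scale scalerDr. Qed.
Fact kpoly_scaleDl p : {morph kpoly_scale^~ p : a b / a + b}.
Proof. by move=> a b; rewrite /kpoly_scale !scalerDl. Qed.
HB.instance Definition _ := GRing.Zmodule_isLmodule.Build k kpoly
  kpoly_scaleA kpoly_scale1 kpoly_scaleDr kpoly_scaleDl.
Fact kpoly_scaleAl (a : k) (p q : kpoly) : a *: (p * q) = (a *: p) * q.
Proof. exact: (@scalerAl _ {poly C}). Qed.
HB.instance Definition _ :=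
  GRing.LSemiModule_isLSemiAlgebra.Build k kpoly kpoly_scaleAl.
HB.instance Definition _ := GRing.LSemiAlgebra_isComSemiAlgebra.Build k kpoly.

Definition ev (c : C) (p : kpoly) : C := (p : {poly C}).[c].
Fact ev_nmod c : nmod_morphism (ev c).
Proof. by split=> [|p q]; rewrite /ev ?horner0 ?hornerD. Qed.
Fact ev_monoid c : monoid_morphism (ev c).
Proof. by split=> [|p q]; rewrite /ev ?hornerM // hornerC. Qed.
Fact ev_scal c : scalable (ev c).
Proof. by move=> a p; rewrite /ev hornerZ mulr_algl. Qed.
HB.instance Definition _ c :=
  GRing.isNmodMorphism.Build kpoly C (ev c) (ev_nmod c).
HB.instance Definition _ c :=
  GRing.isMonoidMorphism.Build kpoly C (ev c) (ev_monoid c).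
HB.instance Definition _ c :=
  GRing.isScalable.Build k kpoly C *:%R (ev c) (ev_scal c).
End PolynomialAlgebra.

Section HopfAlgebra.
Variable k : fieldType.

Record hopfAlgType := HopfAlg {
  hopf_sort :> algType k;
  comul : hopf_sort -> hopf_sort ⊗ hopf_sort;
  counit : hopf_sort -> k;
  antipode : hopf_sort -> hopf_sort;
  comul_linear : linear comul;
  comul_monoid : monoid_morphism comul;
  counit_linear : scalar counit;
  counit_monoid : monoid_morphism counit;
  antipode_linear : linear antipode;
  comulA : forall h, tassoc (tmap comul id (comul h)) = tmap id comul (comul h);
  counitl : forall h, tlift (fun x y => counit x *: y) (comul h) = h;
  counitr : forall h, tlift (fun x y => counit y *: x) (comul h) = h;
  antipodel : forall h, tlift (fun x y => antipode x * y) (comul h) = (counit h)%:A;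
  antipoder : forall h, tlift (fun x y => x * antipode y) (comul h) = (counit h)%:A;
  antipode_bij : bijective antipode }.

Record comodAlgType (H : hopfAlgType) := ComodAlg {
  comod_sort :> algType k;
  coact : comod_sort -> comod_sort ⊗ H;
  coact_linear : linear coact;
  coact_monoid : monoid_morphism coact;
  coactA : forall a, tassoc (tmap coact id (coact a)) = tmap id (@comul H) (coact a);
  coact1 : forall a, tlift (fun x h => counit h *: x) (coact a) = a }.

End HopfAlgebra.

Arguments comul {k h0} _ : rename.
Arguments counit {k h0} _ : rename.
Arguments antipode {k h0} _ : rename.
Arguments coact {k H c} _.

Section Bundles.
Variables (k : fieldType) (H : hopfAlgType k).

(* An H-comodule algebra with a morphism from C to its center, landing in the
   coinvariants; is_bundle adds that C is the base of a Galois extension. *)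
Record centralExt (C : comAlgType k) := CentralExt {
  ext_alg :> comodAlgType H;
  ext_base : {lrmorphism C -> ext_alg};
  ext_central : forall c x, ext_base c * x = x * ext_base c;
  ext_coinv : forall c, coact (ext_base c) = ext_base c ⊗ 1 }.

Section ExtAlgebra.
Variables (C : comAlgType k) (A : centralExt C).

(* A as an algebra over C rather than over k. *)
Definition over_base : Type := A.
HB.instance Definition _ := GRing.NzRing.copy over_base A.
Definition over_base_scale (c : C) (x : over_base) : over_base := ext_base A c * x.
Fact over_base_scaleA c d x :
  over_base_scale c (over_base_scale d x) = over_base_scale (c * d) x.
Proof. by rewrite /over_base_scale rmorphM mulrA. Qed.
Fact over_base_scale1 : left_id 1 over_base_scale.
Proof. by move=> x; rewrite /over_base_scale rmorph1 mul1r. Qed.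
Fact over_base_scaleDr : right_distributive over_base_scale +%R.
Proof. by move=> c x y; rewrite /over_base_scale mulrDr. Qed.
Fact over_base_scaleDl x : {morph over_base_scale^~ x : c d / c + d}.
Proof. by move=> c d; rewrite /over_base_scale rmorphD mulrDl. Qed.
HB.instance Definition _ := GRing.Zmodule_isLmodule.Build C over_base
  over_base_scaleA over_base_scale1 over_base_scaleDr over_base_scaleDl.
Fact over_base_scaleAl (c : C) (x y : over_base) : c *: (x * y) = (c *: x) * y.
Proof. exact: mulrA. Qed.
HB.instance Definition _ :=
  GRing.LSemiModule_isLSemiAlgebra.Build C over_base over_base_scaleAl.
Fact over_base_scaleAr (c : C) (x y : over_base) : c *: (x * y) = x * (c *: y).
Proof. by rewrite [LHS]mulrA [c *: y]/(ext_base A c * y) mulrA -ext_central. Qed.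
HB.instance Definition _ :=
  GRing.LSemiAlgebra_isSemiAlgebra.Build C over_base over_base_scaleAr.

Definition galois_map : over_base ⊗ over_base -> A ⊗ H :=
  tlift (fun a b : over_base => ((a : A) ⊗ 1 : A ⊗ H) * coact (b : A)).

Definition is_bundle : Prop :=
  [/\ injective (ext_base A),
      forall a : A, coact a = a ⊗ 1 -> exists c, a = ext_base A c,
      bijective galois_map & faithfully_flat over_base].

End ExtAlgebra.

Record bundle (C : comAlgType k) := Bundle {
  bundle_ext :> centralExt C;
  bundleP : is_bundle bundle_ext }.

(* Isomorphisms are over C: they restrict to the identity of the base. *)
Definition ext_iso (C : comAlgType k) (A A' : centralExt C) : Prop :=
  exists phi : {lrmorphism A -> A'},
    [/\ bijective phi, forall c, phi (ext_base A c) = ext_base A' c &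
        forall a, coact (phi a) = tmap phi id (coact a)].

Section PushForward.
Variables (C C' : comAlgType k) (f : {lrmorphism C -> C'}) (A : bundle C).

Definition push_alg : Type := along f ⊗ over_base A.
HB.instance Definition _ := GRing.PzRing.on push_alg.

(* Library algebras are nonzero; here this follows from faithful flatness. *)
Fact push_alg_neq0 : (1 : push_alg) != 0.
Proof.
apply/eqP => e10; have [_ _ _ ff] := bundleP A.
have t0 (x : push_alg) : x = 0 by rewrite -[x]mul1r e10 mul0r.
pose z : {linear along f -> along f} := \0.
have [_ tz] := ff _ _ _ z z.
have zz : exact_at z z.
  apply: tz => y; split=> _; last exact: t0.
  by exists 0; rewrite [LHS]t0; apply/esym/t0.
have [x /esym /eqP] := (zz 1).1 (erefl _).
by rewrite oner_eq0.
Qed.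
HB.instance Definition _ := GRing.PzSemiRing_isNonZero.Build push_alg push_alg_neq0.

Definition push_scale (a : k) (x : push_alg) : push_alg :=
  (a%:A : C) *: (x : along f ⊗ over_base A).
Fact push_scaleA a b x : push_scale a (push_scale b x) = push_scale (a * b) x.
Proof. by rewrite /push_scale scalerA -scalerAl mul1r scalerA. Qed.
Fact push_scale1 : left_id 1 push_scale.
Proof. by move=> x; rewrite /push_scale !scale1r. Qed.
Fact push_scaleDr : right_distributive push_scale +%R.
Proof. by move=> a x y; rewrite /push_scale scalerDr. Qed.
Fact push_scaleDl x : {morph push_scale^~ x : a b / a + b}.
Proof. by move=> a b; rewrite /push_scale !scalerDl. Qed.
HB.instance Definition _ := GRing.Zmodule_isLmodule.Build k push_alg
  push_scaleA push_scale1 push_scaleDr push_scaleDl.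
Fact push_scaleAl (a : k) (x y : push_alg) : a *: (x * y) = (a *: x) * y.
Proof. exact: (@tens_scaleAl C (along f) (over_base A)). Qed.
HB.instance Definition _ :=
  GRing.LSemiModule_isLSemiAlgebra.Build k push_alg push_scaleAl.
Fact push_scaleAr (a : k) (x y : push_alg) : a *: (x * y) = x * (a *: y).
Proof. exact: (@tens_scaleAr C (along f) (over_base A)). Qed.
HB.instance Definition _ :=
  GRing.LSemiAlgebra_isSemiAlgebra.Build k push_alg push_scaleAr.

Definition push_pure (c : C') (a : A) : push_alg := (c : along f) ⊗ (a : over_base A).

Definition push_coact : push_alg -> push_alg ⊗ H :=
  tlift (fun (c : along f) (a : over_base A) =>
           tmap (push_pure c) id (coact (a : A))).

Definition push_base (c : C') : push_alg := push_pure c 1.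

Lemma push_pureDr c a b : push_pure c (a + b) = push_pure c a + push_pure c b.
Proof. exact: pureDr. Qed.
Lemma push_pureDl c d a : push_pure (c + d) a = push_pure c a + push_pure d a.
Proof. exact: (@pureDl _ (along f)). Qed.
Lemma push_pureB c d a : push_pure c (ext_base A d * a) = push_pure (f d * c) a.
Proof. exact/esym/(@pureZ _ (along f) (over_base A)). Qed.
Lemma push_pureM c d a b :
  push_pure c a * push_pure d b = push_pure (c * d) (a * b).
Proof. exact: (@pureM _ (along f) (over_base A)). Qed.
Lemma push_pureZ r c a : r *: push_pure c a = push_pure (r *: c) a.
Proof.
have e : f r%:A * c = r *: c by rewrite rmorph_alg mulr_algl.
by rewrite -e; apply: (@pureZl _ (along f) (over_base A)).
Qed.
Lemma push_pureZr r c a : push_pure c (r *: a) = r *: push_pure c a.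
Proof.
rewrite push_pureZ -[r *: a]mulr_algl -(rmorph_alg (ext_base A)) push_pureB.
by rewrite rmorph_alg mulr_algl.
Qed.
Lemma push_pure_linear c : linear (push_pure c).
Proof. by move=> r a b; rewrite push_pureDr push_pureZr. Qed.

Lemma push_ind (P : push_alg -> Prop) :
  P 0 -> (forall x y, P x -> P y -> P (x + y)) ->
  (forall c a, P (push_pure c a)) -> forall x, P x.
Proof. exact: (@tens_ind _ (along f) (over_base A)). Qed.

Let idl : linear (@id H). Proof. by []. Qed.
Let tpD c := tmapD (push_pure_linear c) idl.
Let tp0 c := tmap0 (push_pure_linear c) idl.
Let tpE c a (h : H) := tmapE (push_pure_linear c) idl a h.

Lemma tmap_pushB c d (z : A ⊗ H) :
  tmap (push_pure c) id ((ext_base A d ⊗ 1) * z) = tmap (push_pure (f d * c)) id z.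
Proof.
elim/tens_ind: z => [|x y IH IH'|a h].
- by rewrite mulr0 !tp0.
- by rewrite mulrDr !tpD IH IH'.
- by rewrite pureM mul1r !tpE push_pureB.
Qed.

Lemma push_coact_bal : balanced (fun (c : along f) (a : over_base A) =>
  tmap (push_pure c) id (coact (a : A))).
Proof.
split=> [c d a|c a b|r c a].
- elim/tens_ind: (coact _) => [|x y IH IH'|a0 h].
  + by rewrite !tp0 addr0.
  + by rewrite !tpD IH IH' addrACA.
  + by rewrite !tpE push_pureDl pureDl.
- by rewrite (linD (@coact_linear _ _ A)) tpD.
- rewrite [r *: a]/(ext_base A r * a) (coact_monoid A).2 ext_coinv.
  by rewrite tmap_pushB.
Qed.

Lemma push_coactE c a : push_coact (push_pure c a) = tmap (push_pure c) id (coact a).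
Proof. exact: tliftE push_coact_bal. Qed.
Lemma push_coactD : {morph push_coact : x y / x + y}.
Proof. by move=> x y; apply: tliftD push_coact_bal. Qed.
Lemma push_coact0 : push_coact 0 = 0.
Proof. exact: tlift0 push_coact_bal. Qed.

Fact push_coact_linear : linear push_coact.
Proof.
move=> r x y; rewrite push_coactD; congr (_ + _).
elim/push_ind: x => [|x x' IH IH'|c a].
- by rewrite scaler0 push_coact0 scaler0.
- by rewrite scalerDr !push_coactD scalerDr IH IH'.
- rewrite push_pureZ -[r *: c]mulr_algl -(rmorph_alg f) -push_pureB rmorph_alg.
  rewrite mulr_algl !push_coactE (linZ (@coact_linear _ _ A)).
  by rewrite (linZ (tmap_lin (push_pure_linear c) idl)).
Qed.

Lemma tmap_pushM c d (z t : A ⊗ H) :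
  tmap (push_pure c) id z * tmap (push_pure d) id t =
  tmap (push_pure (c * d)) id (z * t).
Proof.
elim/tens_ind: z => [|x y IH IH'|a h].
- by rewrite mul0r !tp0 mul0r.
- by rewrite mulrDl !tpD mulrDl IH IH'.
elim/tens_ind: t => [|x y IH IH'|b g].
- by rewrite mulr0 !tp0 mulr0.
- by rewrite mulrDr !tpD mulrDr IH IH'.
- by rewrite [X in _ = tmap _ _ X]pureM !tpE [LHS]pureM push_pureM.
Qed.

Fact push_coact_monoid : monoid_morphism push_coact.
Proof.
split=> [|x y].
  rewrite [LHS](push_coactE 1 1) (coact_monoid A).1.
  exact: tpE.
elim/push_ind: x => [|x x' IH IH'|c a].
- by rewrite mul0r push_coact0 mul0r.
- by rewrite mulrDl !push_coactD mulrDl IH IH'.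
elim/push_ind: y => [|y y' IH IH'|d b].
- by rewrite mulr0 push_coact0 mulr0.
- by rewrite mulrDr !push_coactD mulrDr IH IH'.
- by rewrite push_pureM !push_coactE tmap_pushM (coact_monoid A).2.
Qed.

Fact push_coactA x :
  tassoc (tmap push_coact id (push_coact x)) = tmap id (@comul k H) (push_coact x).
Proof.
have cl := push_coact_linear; have ul := @comul_linear _ H.
have il : linear (@id push_alg) by [].
have al := @coact_linear _ _ A; have iA : linear (@id A) by [].
elim/push_ind: x => [|x y IH IH'|c a].
- by rewrite push_coact0 !tmap0 // tassoc0.
- by rewrite push_coactD !tmapD // tassocD IH IH'.
rewrite push_coactE.
have L (z : A ⊗ H) : tassoc (tmap push_coact id (tmap (push_pure c) id z)) =
    tmap (push_pure c) id (tassoc (tmap coact id z)).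
  elim/tens_ind: z => [|x y IH IH'|b h].
  - by rewrite !(tmap0, tassoc0) //; apply: push_pure_linear.
  - rewrite tpD (tmapD cl idl) tassocD IH IH' (tmapD al idl) tassocD.
    by rewrite tmapD //; apply: push_pure_linear.
  - rewrite tpE (tmapE cl idl) (tmapE al idl) push_coactE.
    elim/tens_ind: (coact b) => [|x y IH IH'|a0 g].
    + rewrite tp0 !pure0 !tassoc0 tmap0 //; exact: push_pure_linear.
    + rewrite tpD !pureDl !tassocD IH IH' tmapD //; exact: push_pure_linear.
    + rewrite tpE !tassocE tmapE //; exact: push_pure_linear.
have K (z : A ⊗ H) : tmap id (@comul k H) (tmap (push_pure c) id z) =
    tmap (push_pure c) id (tmap id (@comul k H) z).
  have pl := push_pure_linear c.
  elim/tens_ind: z => [|x y IH IH'|b h].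
  - by rewrite !tmap0.
  - by rewrite !tmapD // IH IH'.
  - by rewrite !tmapE.
by rewrite L K coactA.
Qed.

Fact push_coact1 x : tlift (fun y h => counit h *: y) (push_coact x) = x.
Proof.
have bal (V : lmodType k) : balanced (fun (y : V) (h : H) => counit h *: y).
  have D g h : @counit _ H (g + h) = counit g + counit h.
    by have := @counit_linear _ H 1 g h; rewrite scale1r mul1r.
  have Z r h : @counit _ H (r *: h) = r * counit h.
    have c0 : @counit _ H 0 = 0.
      by apply: (addrI (@counit _ H 0)); have := D 0 0; rewrite !addr0 => <-.
    by have := @counit_linear _ H r h 0; rewrite c0 !addr0.
  split=> *; rewrite ?scalerDr ?D ?scalerDl //.
  by rewrite Z scalerA mulrC.
elim/push_ind: x => [|x y IH IH'|c a].
- by rewrite push_coact0 tlift0.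
- by rewrite push_coactD tliftD // IH IH'.
rewrite push_coactE -[in RHS](coact1 a).
elim/tens_ind: (coact a) => [|x y IH IH'|b h].
- by rewrite tp0 !tlift0 // /push_pure -[0]addr0 -[RHS]/(push_pure c 0);
  apply/esym/(addrI (push_pure c 0)); rewrite -push_pureDr !addr0.
- by rewrite tpD !tliftD // IH IH' push_pureDr.
- by rewrite tpE !tliftE // push_pureZr.
Qed.

Definition push_comod : comodAlgType H :=
  ComodAlg push_coact_linear push_coact_monoid push_coactA push_coact1.

Fact push_base_nmod : nmod_morphism push_base.
Proof.
split=> [|c d]; last exact: push_pureDl.
exact: (@pure0 _ (along f) (over_base A)).
Qed.
Fact push_base_monoid : monoid_morphism push_base.
Proof. by split=> // c d; rewrite push_pureM mulr1. Qed.
Fact push_base_scal : scalable push_base.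
Proof. by move=> r c; rewrite push_pureZ. Qed.
HB.instance Definition _ :=
  GRing.isNmodMorphism.Build C' push_comod push_base push_base_nmod.
HB.instance Definition _ :=
  GRing.isMonoidMorphism.Build C' push_comod push_base push_base_monoid.
HB.instance Definition _ :=
  GRing.isScalable.Build k C' push_comod *:%R push_base push_base_scal.

Fact push_central c (x : push_comod) : push_base c * x = x * push_base c.
Proof.
elim/push_ind: x => [|x y IH IH'|d a].
- by rewrite mulr0 mul0r.
- by rewrite mulrDr mulrDl IH IH'.
- by rewrite !push_pureM mul1r mulr1 mulrC.
Qed.
Fact push_coinv c : coact (push_base c : push_comod) = push_base c ⊗ 1.
Proof. by rewrite [LHS]push_coactE (coact_monoid A).1 tpE. Qed.

Definition push : centralExt C' :=
  @CentralExt C' push_comod push_base push_central push_coinv.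

End PushForward.
End Bundles.

Section Homotopy.
Variables (k : fieldType) (H : hopfAlgType k).

Definition homotopy (C : comAlgType k) (A A' : bundle H C) : Prop :=
  exists (D : comAlgType k) (i : {lrmorphism C -> D}) (B : bundle H (kpoly D)),
    [/\ finite_etale i,
        ext_iso (push (ev 0) B) (push i A) &
        ext_iso (push (ev 1) B) (push i A')].

Definition homotopy_equiv (C : comAlgType k) : bundle H C -> bundle H C -> Prop :=
  clos_refl_sym_trans _ (@homotopy C).

Definition homotopy_classes (C : comAlgType k) : Type :=
  {S : bundle H C -> Prop | exists A, S = homotopy_equiv A}.

Definition homotopy_class (C : comAlgType k) (A : bundle H C) :
    homotopy_classes C :=
  exist _ (homotopy_equiv A) (ex_intro _ A erefl).

End Homotopy.

Section Graded.
Variables (k : fieldType) (C : comAlgType k).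

Record grading := Grading {
  homog :> nat -> {pred C};
  homog_submod : forall i, submod_closed (homog i);
  homog1 : 1 \in homog 0;
  homogM : forall i j x y,
    x \in homog i -> y \in homog j -> x * y \in homog (i + j)%N;
  homog_sum : forall x, exists (n : nat) (c : nat -> C),
    (forall i, c i \in homog i) /\ x = \sum_(i < n) c i;
  homog_free : forall (n : nat) (c : nat -> C),
    (forall i, c i \in homog i) -> \sum_(i < n) c i = 0 ->
    forall i : nat, (i < n)%N -> c i = 0 }.

Variable G : grading.

Definition homog0 : {pred C} := G 0%N.

Fact homog0_subalg : subalg_closed homog0.
Proof.
have [_ lc] := homog_submod G 0; split; first exact: homog1.
- exact: lc.
- by move=> x y; apply: (@homogM G 0%N 0%N).
Qed.
HB.instance Definition _ := GRing.isSubalgClosed.Build k C homog0 homog0_subalg.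

Definition degree0 : Type := {x : C | x \in homog0}.
HB.instance Definition _ := SubChoice.on degree0.
HB.instance Definition _ := [SubChoice_isSubComNzRing of degree0 by <:].
HB.instance Definition _ := [SubNmodule_isSubLSemiModule of degree0 by <:].
HB.instance Definition _ := [SubNzSemiRing_SubLSemiModule_isSubLSemiAlgebra of degree0 by <:].
HB.instance Definition _ := [SubLalgebra_isSubAlgebra of degree0 by <:].

Definition degree0_incl : degree0 -> C := val.
HB.instance Definition _ := GRing.RMorphism.on degree0_incl.
HB.instance Definition _ := GRing.Linear.on degree0_incl.
End Graded.

(* Main.v *)
From HB Require Import structures.
Require Import Defs.
From Stdlib Require Import Relation_Operators.
From mathcomp Require Import all_boot all_algebra.
From mathcomp Require Import boolp.

Set Implicit Arguments.
Unset Strict Implicit.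
Unset Printing Implicit Defensive.

Import GRing.Theory.
Local Open Scope ring_scope.

(** Homogenization, c = Σ c_i |-> Σ c_i t^i, is a morphism h : C -> C[t] with
    [1] h = id and [0] h = ι p, where p : C -> C_0 is the projection.  Hence
    h_* A is a homotopy from ι_* p_* A to A, while p_* ι_* A ≅ A because
    p ι = id: the map induced by p is inverse to the one induced by ι.

    Every isomorphism needed here is obtained from a mere morphism, because a
    morphism between two bundles with the same base is bijective; and morphisms
    out of f_* A are morphisms out of A lying over f.

    Push-forward along f carries a homotopy over D to one over D ⊗_C C', and
    D ⊗_C C' has to be nonzero since algebras are.  This may fail for a general
    f, as D need not be faithful over C, but it holds for ι, which has a
    retraction, and for p: if D ⊗_C C_0 = 0, every linear form on D takes values
    in the ideal C_+, hence, by means of a dual basis, in all its powers, whose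
    intersection is 0. *)

(** * Packaging of morphisms, tensor products, exactness *)

Section Bundling.
Variables (R : pzRingType) (U V : lmodType R) (f : U -> V) (lf : linear f).

Definition mk_linear : {linear U -> V} :=
  HB.pack f (GRing.isLinear.Build R U V *:%R f lf).

Lemma mk_linearE x : mk_linear x = f x.
Proof. by []. Qed.
End Bundling.

Section BundlingLR.
Variables (k : fieldType) (A B : algType k) (f : A -> B).
Hypotheses (lf : linear f) (mf : monoid_morphism f).

Definition mk_lrmorphism : {lrmorphism A -> B} :=
  HB.pack f (GRing.isLinear.Build k A B *:%R f lf)
            (GRing.isMonoidMorphism.Build A B f mf).

Lemma mk_lrmorphismE x : mk_lrmorphism x = f x.
Proof. by []. Qed.
End BundlingLR.

Section Tensor.
Variable R : comPzRingType.
Implicit Types M N P : lmodType R.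

Lemma pure0r M N (m : M) : m ⊗ (0 : N) = 0.
Proof. by rewrite -(scale0r (0 : N)) -pureZ scale0r pure0. Qed.

Lemma pureZr M N a (m : M) (n : N) : a *: (m ⊗ n) = m ⊗ (a *: n).
Proof. by rewrite pureZl pureZ. Qed.

Lemma morphD0 (U V : zmodType) (f : U -> V) : {morph f : x y / x + y} -> f 0 = 0.
Proof. by move=> fD; apply: (addrI (f 0)); rewrite -fD !addr0. Qed.

Lemma tens_ext M N (V : zmodType) (f g : M ⊗ N -> V) :
  {morph f : x y / x + y} -> {morph g : x y / x + y} ->
  (forall m n, f (m ⊗ n) = g (m ⊗ n)) -> f =1 g.
Proof.
move=> fD gD fg; apply: tens_ind => [|x y IHx IHy|//].
- by rewrite !morphD0.
- by rewrite fD gD IHx IHy.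
Qed.

Lemma tmap_id M N : tmap id id =1 (id : M ⊗ N -> M ⊗ N).
Proof. by apply: tens_ext => // [x y|m n]; rewrite ?tmapD ?tmapE. Qed.

Lemma tlift_morphD M N (P V : zmodType) (phi : P -> M -> N -> V) z :
  (forall p, balanced (phi p)) ->
  (forall m n, {morph phi^~ m ^~ n : p q / p + q}) ->
  {morph (fun p => tlift (phi p) z) : p q / p + q}.
Proof.
move=> bal D p q; elim/tens_ind: z => [|x y IHx IHy|m n].
- by rewrite !tlift0 ?addr0.
- by rewrite !tliftD // IHx IHy addrACA.
- by rewrite !tliftE // D.
Qed.
End Tensor.

Section Exactness.
Variable R : comPzRingType.

(** Exactness at the middle only sees the kernel of the second map, so [c] has to be injective but
    not onto. The two rings may differ, which lets [push_ff] compare modules over C' with modules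
    over C. *)
Lemma exact_at_transport (L M N : lmodType R) (R' : comPzRingType)
    (L' M' N' : lmodType R') (u : L -> M) (v : M -> N)
    (u' : L' -> M') (v' : M' -> N') (a : L -> L') (b : M -> M') (c : N -> N') :
  bijective a -> bijective b -> injective c -> c 0 = 0 ->
  (forall x, u' (a x) = b (u x)) -> (forall x, v' (b x) = c (v x)) ->
  exact_at u v <-> exact_at u' v'.
Proof.
move=> [a' aK a'K] [b' bK b'K] cI c0 eu ev; split=> ex y.
- rewrite -[y]b'K ev -c0; split=> [/cI/ex[x <-]|[x]].
  + by exists (a x); rewrite eu.
  + by rewrite -[x]a'K eu => /(can_inj bK) e; congr (c _); apply/ex; exists (a' x).
- split=> [e|[x <-]].
  + have [x] := (ex (b y)).1 (etrans (ev y) (etrans (congr1 c e) c0)).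
    by rewrite -[x]a'K eu => /(can_inj bK) ?; exists (a' x).
  + by apply: cI; rewrite c0 -ev -eu; apply/ex; exists (a x).
Qed.
End Exactness.

(** * Galois extensions and descent *)

Section Galois.
Variables (k : fieldType) (H : hopfAlgType k) (C : comAlgType k).
Variable A : centralExt H C.

Local Notation OA := (over_base A).

Lemma over_baseZ (c : C) (x : OA) : c *: x = (ext_base A c * (x : A) : A).
Proof. by []. Qed.

Lemma galois_balanced :
  balanced (fun a b : OA => ((a : A) ⊗ 1 : A ⊗ H) * coact (b : A)).
Proof.
split=> [a a' b|a b b'|c a b].
- by rewrite (pureDl (a : A)) mulrDl.
- by rewrite (linD (@coact_linear _ _ A)) mulrDr.
- rewrite !over_baseZ (coact_monoid A).2 ext_coinv mulrA pureM mulr1.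
  by rewrite ext_central.
Qed.

Lemma galois_mapE (a b : OA) :
  galois_map (a ⊗ b) = ((a : A) ⊗ 1 : A ⊗ H) * coact (b : A).
Proof. exact: tliftE galois_balanced. Qed.

Lemma galois_mapD : {morph @galois_map _ _ _ A : x y / x + y}.
Proof. by move=> x y; apply: tliftD galois_balanced. Qed.

Lemma galois_mapMl (a : OA) z :
  galois_map ((a ⊗ 1) * z) = ((a : A) ⊗ 1 : A ⊗ H) * galois_map z.
Proof.
elim/tens_ind: z => [|x y IHx IHy|x y].
- by rewrite mulr0 (morphD0 galois_mapD) mulr0.
- by rewrite mulrDr !galois_mapD mulrDr IHx IHy.
- by rewrite pureM mul1r !galois_mapE mulrA pureM mulr1.
Qed.

Hypothesis ffA : faithfully_flat OA.

Lemma ext_base_linear : linear (ext_base A : C^o -> OA).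
Proof. by move=> a x y; rewrite rmorphD [a *: x]/(a * x) rmorphM. Qed.
Let b : {linear C^o -> OA} := mk_linear ext_base_linear.

Let act (c : C^o) (x : OA) : OA := c *: x.
Let act_bal : balanced act.
Proof.
by split=> *; rewrite /act ?scalerDl ?scalerDr // scalerA mulrC.
Qed.
Let actE z : z = (1 : C^o) ⊗ tlift act z.
Proof.
elim/tens_ind: z => [|x y IHx IHy|c x].
- by rewrite tlift0 // pure0r.
- by rewrite tliftD // pureDr -IHx -IHy.
- by rewrite tliftE // -pureZ [c *: _]mulr1.
Qed.

Let mul_bal : balanced (fun x y : OA => x * y).
Proof. by split=> *; rewrite ?mulrDl ?mulrDr // -scalerAl scalerAr. Qed.
Let mul (z : OA ⊗ OA) : OA := tlift (fun x y : OA => x * y) z.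

Let mul_base z : mul (tmap b id z) = tlift act z.
Proof.
apply: (@tens_ext _ _ _ _ (fun z => mul (tmap b id z))) z => [x y|x y|c x].
- by rewrite (tmapD (linearP b)) // /mul tliftD.
- exact: tliftD.
- by rewrite (tmapE (linearP b)) // /mul !tliftE.
Qed.

(** Faithful flatness reflects exactness of 0 -> C -> A. After tensoring with A the map becomes C ⊗
    A -> A ⊗ A, which is injective: multiplying the two factors gives back the action C ⊗ A -> A,
    and by [actE] a tensor is determined by its image under the action. *)
Lemma ext_base_inj : injective (ext_base A).
Proof.
pose z0 : {linear C^o -> C^o} := \0.
have /ffA ex : exact_at (tmap z0 id : C^o ⊗ OA -> C^o ⊗ OA) (tmap b id).
  move=> y; split=> [e|[x <-]].
  - exists 0; rewrite (tmap0 (linearP z0)) //.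
    by rewrite [RHS]actE -mul_base e /mul tlift0 // pure0r.
  - have -> : tmap z0 id x = 0.
      elim/tens_ind: x => [|x y' IHx IHy|c x].
      + exact: (tmap0 (linearP z0)).
      + by rewrite (tmapD (linearP z0)) // IHx IHy addr0.
      + by rewrite (tmapE (linearP z0)) // (_ : z0 c = 0) ?pure0.
    exact: (tmap0 (linearP b)).
move=> c d /eqP; rewrite -subr_eq0 -rmorphB => /eqP/(ex (c - d)).1 [x e].
by apply/eqP; rewrite -subr_eq0 -e.
Qed.

(* Faithfully flat descent: C -> A -> A ⊗ A is exact, since it becomes split
   after tensoring with A. *)
Lemma ff_descent (a : OA) : a ⊗ (1 : OA) = (1 : OA) ⊗ a -> exists c, a = ext_base A c.
Proof.
pose d (x : OA) : OA ⊗ OA := 1 ⊗ x - x ⊗ 1.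
have dl : linear d.
  move=> c x y; rewrite /d pureDr pureDl scalerBr pureZr pureZl.
  by rewrite opprD addrACA.
pose D : {linear OA -> tensor OA OA} := mk_linear dl.
have DE x : D x = d x by [].
(* [q] multiplies the last two factors and serves as a contracting homotopy: by [qD], a tensor [z]
   killed by [D ⊗ id] equals [1 ⊗ mul z], so it comes from C ⊗ A. *)
pose q (z : OA ⊗ OA ⊗ OA) : OA ⊗ OA := tmap id mul (tassoc z).
have mulL : linear mul.
  move=> c x y; rewrite /mul tliftD //; congr (_ + _).
  elim/tens_ind: x => [|x x' IHx IHy|x x'].
  - by rewrite scaler0 !tlift0 // scaler0.
  - by rewrite scalerDr !tliftD // scalerDr IHx IHy.
  - by rewrite pureZl !tliftE // scalerAl.
have il : linear (@id OA) by [].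
have qD z : q (tmap D id z) = (1 : OA) ⊗ mul z - z.
  elim/tens_ind: z => [|x y IHx IHy|x y].
  - by rewrite (tmap0 (linearP D)) // /q tassoc0 tmap0 // /mul tlift0 // pure0r subr0.
  - rewrite (tmapD (linearP D)) // /q tassocD tmapD // [X in X + _]IHx.
    by rewrite [X in _ + X]IHy /mul tliftD // pureDr opprD addrACA.
  - rewrite (tmapE (linearP D)) // DE /d pureDl -scaleN1r pureZl.
    rewrite /q tassocD !tassocE (tmapD il mulL) !(tmapE il mulL) /mul !tliftE //.
    by rewrite mul1r -pureZl scaleN1r.
have /ffA ex : exact_at (tmap b id : C^o ⊗ OA -> OA ⊗ OA) (tmap D id).
  move=> y; split=> [e|[x <-]].
  - exists ((1 : C^o) ⊗ mul y); rewrite (tmapE (linearP b)) //.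
    have := qD y; rewrite e /q tassoc0 tmap0 // => /esym/eqP.
    by rewrite subr_eq0 [b 1]rmorph1 => /eqP.
  - elim/tens_ind: x => [|x y' IHx IHy|c x].
    + by rewrite (tmap0 (linearP b)) // (tmap0 (linearP D)).
    + by rewrite (tmapD (linearP b)) // (tmapD (linearP D)) // IHx IHy addr0.
    + rewrite (tmapE (linearP b)) // (tmapE (linearP D)) //.
      suff -> : D (b c) = 0 by rewrite pure0.
      rewrite DE /d.
      have -> : b c = c *: (1 : OA) by rewrite over_baseZ mulr1.
      by rewrite -pureZ subrr.
move=> e; have [x <-] : exists x, b x = a.
  by apply/ex; rewrite DE /d e subrr.
by exists x.
Qed.

Hypothesis galA : bijective (@galois_map _ _ _ A).

(* A coinvariant a satisfies gal (1 ⊗ a) = gal (a ⊗ 1), so it descends. *)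
Lemma galois_ff_bundle : is_bundle A.
Proof.
split=> //; first exact: ext_base_inj.
move=> a ea; apply: ff_descent.
apply: (bij_inj galA); rewrite !galois_mapE (coact_monoid A).1 mulr1 ea.
by rewrite pureM mul1r mulr1.
Qed.
End Galois.

(** * Morphisms of bundles *)

Section Morphisms.
Variables (k : fieldType) (H : hopfAlgType k).

(** The base map is a bare function, so that a composite can be exchanged for any pointwise equal
    map. *)
Definition over_morph (C C' : comAlgType k) (f : C -> C') (A : centralExt H C)
    (E : centralExt H C') (psi : {lrmorphism A -> E}) : Prop :=
  (forall c, psi (ext_base A c) = ext_base E (f c)) /\
  (forall a, coact (psi a) = tmap psi id (coact a)).

Definition ext_over (C C' : comAlgType k) (f : C -> C') (A : centralExt H C)
    (E : centralExt H C') : Prop :=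
  exists psi : {lrmorphism A -> E}, over_morph f psi.

Lemma ext_over_comp (C C' C'' : comAlgType k) (f : C -> C') (g : C' -> C'') h
    (A : centralExt H C) (B : centralExt H C') (E : centralExt H C'') :
  h =1 g \o f -> ext_over f A B -> ext_over g B E -> ext_over h A E.
Proof.
move=> hE [psi [psib psic]] [phi [phib phic]].
exists (mk_lrmorphism (linearP (phi \o psi))
   (conj (rmorph1 (phi \o psi)) (rmorphM (phi \o psi)))); split=> [c|a].
- by rewrite mk_lrmorphismE /= psib phib hE.
- rewrite mk_lrmorphismE /= phic psic.
  elim/tens_ind: (coact a) => [|x y IHx IHy|x h'].
  + by rewrite !tmap0 //; apply: linearP.
  + by rewrite !tmapD // ?IHx ?IHy //; apply: linearP.
  + by rewrite !tmapE //; apply: linearP.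
Qed.

Section Bijectivity.
Variables (C C' : comAlgType k) (f : C -> C') (A : centralExt H C)
  (E : centralExt H C') (psi : {lrmorphism A -> E}) (psiP : over_morph f psi).
Variables (N : lmodType C') (theta : over_base A -> N).
Hypothesis (thetaD : {morph theta : x y / x + y}).
Hypothesis (thetaZ : forall c x, theta (c *: x) = f c *: theta x).
Variable inv : A ⊗ H -> over_base A ⊗ over_base A.
Hypothesis (galK : cancel (@galois_map _ _ _ A) inv).
Hypothesis (invK : cancel inv (@galois_map _ _ _ A)).

Let psib := psiP.1.
Let psic := psiP.2.
Let psil : linear psi := linearP psi.
Let idH : linear (@id H). Proof. by []. Qed.

(** The inverse of the Galois map is given as a mere function; its additivity and left A-linearity
    are pulled back through [galois_map]. *)
Let invD : {morph inv : x y / x + y}.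
Proof. by move=> x y; apply: (can_inj galK); rewrite galois_mapD !invK. Qed.

Let invMl (a : A) w : inv ((a ⊗ 1) * w) = ((a : over_base A) ⊗ 1) * inv w.
Proof. by apply: (can_inj galK); rewrite galois_mapMl !invK. Qed.

Let J (e : over_base E) (x y : over_base A) : over_base E ⊗ N :=
  (e * psi x : over_base E) ⊗ theta y.

Let J_bal e : balanced (J e).
Proof.
split=> [x x' y|x y y'|c x y]; rewrite /J.
- by rewrite rmorphD mulrDr pureDl.
- by rewrite thetaD pureDr.
- have -> : psi (c *: x) = ext_base E (f c) * psi x by rewrite -psib -rmorphM.
  by rewrite thetaZ -pureZ over_baseZ mulrA -ext_central -mulrA.
Qed.

Let JJ e z := tlift (J e) z.

Let JJDl z : {morph (fun e => JJ e z) : e e' / e + e'}.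
Proof.
apply: (tlift_morphD _ J_bal) => x y e e'.
by rewrite /J mulrDl pureDl.
Qed.

Let JJM e (a : over_base A) z : JJ e ((a ⊗ 1) * z) = JJ (e * psi a) z.
Proof.
rewrite /JJ; elim/tens_ind: z => [|x y IHx IHy|x y].
- by rewrite mulr0 !tlift0.
- by rewrite mulrDr !tliftD // IHx IHy.
- by rewrite pureM mul1r !tliftE // /J rmorphM mulrA.
Qed.

Let kappa (e : E) (h : H) := JJ e (inv (1 ⊗ h)).

Let kappa_bal : balanced kappa.
Proof.
split=> [e e' h|e h h'|a e h]; rewrite /kappa.
- exact: JJDl.
- by rewrite pureDr invD; apply: tliftD.
- have -> : (1 : A) ⊗ (a *: h) = ((a%:A : A) ⊗ 1) * (1 ⊗ h) :> A ⊗ H.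
    by rewrite pureM mulr1 mul1r pureZ.
  by rewrite invMl JJM rmorph_alg; congr (JJ _ _); exact/esym/(@mulr_algr _ E).
Qed.

(* e ⊗ h |-> e ψ(h') ⊗ θ(h''), where h' ⊗ h'' is the preimage of 1 ⊗ h under the
   Galois map of A. With N = E it inverts the Galois map of a push-forward; with
   N = A, C' = C it inverts E ⊗ A -> E ⊗ E -> E ⊗ H. *)
Definition galois_lift : E ⊗ H -> over_base E ⊗ N := tlift kappa.

Lemma galois_liftD : {morph galois_lift : x y / x + y}.
Proof. by move=> x y; apply: tliftD. Qed.

(** Write a ⊗ h as (a ⊗ 1)(1 ⊗ h): left A-linearity of [inv] moves a out, and [JJ] absorbs it into e
    as ψ(a). *)
Lemma galois_lift_mor e w :
  galois_lift ((e ⊗ 1) * tmap psi id w) = JJ e (inv w).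
Proof.
elim/tens_ind: w => [|x y IHx IHy|a h].
- by rewrite tmap0 // mulr0 (morphD0 galois_liftD) (morphD0 invD) /JJ tlift0.
- by rewrite tmapD // mulrDr galois_liftD IHx IHy invD /JJ tliftD.
- rewrite tmapE // pureM mul1r /galois_lift tliftE // /kappa.
  have -> : a ⊗ h = (a ⊗ 1) * (1 ⊗ h) by rewrite pureM mulr1 mul1r.
  by rewrite invMl JJM.
Qed.

(** Half of the inversion: the coaction of a is the Galois image of 1 ⊗ a, so [inv] recovers 1 ⊗ a
    from it. *)
Lemma galois_lift_coact e (a : A) :
  galois_lift ((e ⊗ 1) * coact (psi a)) = (e : over_base E) ⊗ theta a.
Proof.
rewrite psic galois_lift_mor.
have -> : coact a = galois_map ((1 : over_base A) ⊗ (a : over_base A)).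
  by rewrite galois_mapE; apply/esym/mul1r.
by rewrite galK /JJ tliftE // /J rmorph1 mulr1.
Qed.

(** The other half. Colinearity of ψ makes the Galois map of E restrict along ψ to that of A, where
    [inv] cancels. [W] carries N to E: it is the identity for N = E and ψ itself for N = A. *)
Lemma galois_liftK (W : N -> over_base E) w : linear W ->
  (forall a, W (theta a) = psi a) ->
  galois_map (tmap id W (galois_lift w)) = w.
Proof.
move=> Wl Wt; have iE : linear (@id (over_base E)) by [].
elim/tens_ind: w => [|x y IHx IHy|e h].
- by rewrite (morphD0 galois_liftD) tmap0 // (morphD0 (@galois_mapD _ _ _ E)).
- by rewrite galois_liftD tmapD // galois_mapD IHx IHy.
rewrite /galois_lift tliftE // /kappa.
have L z : galois_map (tmap id W (JJ e z)) = (e ⊗ 1) * tmap psi id (galois_map z).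
  rewrite /JJ; elim/tens_ind: z => [|x y IHx IHy|x y].
  - by rewrite tlift0 // tmap0 // !(morphD0 (@galois_mapD _ _ _ _)) tmap0 // mulr0.
  - by rewrite tliftD // tmapD // !galois_mapD IHx IHy tmapD // mulrDr.
  - rewrite tliftE // tmapE // Wt !galois_mapE psic.
    elim/tens_ind: (coact _) => [|u v IHu IHv|u v].
    + by rewrite mulr0 !tmap0 // !mulr0.
    + by rewrite mulrDr !tmapD // !mulrDr IHu IHv.
    + rewrite pureM !tmapE // !pureM rmorphM.
      by rewrite !mul1r -[X in X ⊗ _]mulrA.
by rewrite L invK tmapE // rmorph1 pureM mulr1 mul1r.
Qed.

End Bijectivity.
End Morphisms.

Section Swap.
Variables (R : comPzRingType) (M N : lmodType R).

Definition tswap : M ⊗ N -> N ⊗ M := tlift (fun m n => n ⊗ m).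

Lemma tswap_balanced : balanced (fun (m : M) (n : N) => n ⊗ m).
Proof. by split=> *; rewrite ?pureDl ?pureDr // pureZ. Qed.
Lemma tswapE m n : tswap (m ⊗ n) = n ⊗ m.
Proof. exact: tliftE tswap_balanced. Qed.
Lemma tswapD : {morph tswap : x y / x + y}.
Proof. by move=> x y; apply: tliftD tswap_balanced. Qed.
End Swap.

Lemma tswapK (R : comPzRingType) (M N : lmodType R) :
  cancel (@tswap R M N) (@tswap R N M).
Proof.
apply: (tens_ext (f := fun x => tswap (tswap x)) (g := id)) => // [x y|m n].
- by rewrite !tswapD.
- by rewrite !tswapE.
Qed.

Lemma inj_surj_bij (T U : choiceType) (f : T -> U) :
  injective f -> (forall y, exists x, f x = y) -> bijective f.
Proof.
move=> fI fS; have fS' y : exists x, f x == y by have [x <-] := fS y; exists x.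
exists (fun y => xchoose (fS' y)) => x; last exact/eqP/(xchooseP (fS' x)).
exact/fI/eqP/(xchooseP (fS' (f x))).
Qed.

(** * Bijectivity by faithfully flat descent *)

Section FaithfullyFlat.
Variables (R : comPzRingType) (P : lmodType R) (ffP : faithfully_flat P).
Variables (M N : lmodType R) (u : {linear M -> N}).

Lemma tmap_null (L Q : lmodType R) (x : L ⊗ P) :
  tmap (\0 : {linear L -> Q}) id x = 0.
Proof.
have nl : linear (\0 : {linear L -> Q}) by exact: linearP.
elim/tens_ind: x => [|x y IHx IHy|m n].
- exact: tmap0.
- by rewrite tmapD // IHx IHy addr0.
- by rewrite tmapE // pure0.
Qed.

(** Injectivity is exactness of M -> M -> N with first map zero, surjectivity that of M -> N -> N
    with second map zero; faithful flatness reflects both. *)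
Lemma ff_bij : bijective (tmap u id : M ⊗ P -> N ⊗ P) -> bijective u.
Proof.
move=> [v uK vK]; have ul : linear u := linearP u.
apply: inj_surj_bij => [x y e|y].
- pose z := (\0 : {linear M -> M}).
  have /ffP ex : exact_at (tmap z id : M ⊗ P -> M ⊗ P) (tmap u id).
    move=> t; split=> [ut0|[s <-]]; last by rewrite tmap_null tmap0.
    have T0 : tmap u id (0 : M ⊗ P) = 0 by rewrite tmap0.
    by exists 0; rewrite tmap_null -[t]uK ut0 -T0 uK.
  have /ex[t] : u (x - y) = 0 by rewrite linearB e subrr.
  by move/esym/eqP; rewrite subr_eq0 => /eqP.
- pose z := (\0 : {linear N -> N}).
  have /ffP ex : exact_at (tmap u id : M ⊗ P -> N ⊗ P) (tmap z id).
    move=> t; split=> [_|_]; last exact: tmap_null.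
    by exists (v t); rewrite vK.
  by apply/ex.
Qed.
End FaithfullyFlat.

Section BundleIso.
Variables (k : fieldType) (H : hopfAlgType k) (C : comAlgType k).
Variables A E : bundle H C.

(** The composite of [T] : E ⊗ A -> E ⊗ E with the Galois map of E is inverted by [galois_lift]. The
    Galois map being bijective, so is [T], and faithful flatness of E descends this to ψ. *)
Lemma bundle_morph_bij (psi : {lrmorphism A -> E}) :
  over_morph id psi -> bijective psi.
Proof.
move=> psiP.
have [_ _ [inv galK invK] _] := bundleP A.
have [_ _ galE ffE] := bundleP E.
have psil : linear (psi : over_base A -> over_base E).
  move=> c x y; rewrite rmorphD; congr (_ + _).
  have := rmorphM psi (ext_base A c) x; rewrite /= psiP.1; exact.
pose u := mk_linear psil.
have idA : linear (@id (over_base A)) by [].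
have idE : linear (@id (over_base E)) by [].
pose T : over_base E ⊗ over_base A -> over_base E ⊗ over_base E := tmap id u.
have TD : {morph T : x y / x + y} := tmapD idE psil.
have galTK : cancel (fun z => galois_map (T z)) (galois_lift psi (@id (over_base A)) inv).
  apply: (tens_ext (f := fun z => galois_lift psi (@id (over_base A)) inv
                                    (galois_map (T z))) (g := id)) => //.
    by move=> x y; rewrite TD galois_mapD (galois_liftD psiP).
  move=> e a; rewrite /T (tmapE idE psil) galois_mapE.
  exact: (galois_lift_coact psiP).
have TK w : galois_map (T (galois_lift psi (@id (over_base A)) inv w)) = w.
  exact: (galois_liftK psiP).
apply: (@ff_bij _ _ ffE _ _ u).
(* Faithful flatness is phrased with E as the right factor, whereas [T] has it on the left. *)
have uT z : tmap u id z = tswap (T (tswap z)) :> over_base E ⊗ over_base E.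
  apply: (tens_ext (g := fun z => tswap (T (tswap z)))) z => [x y|x y|a e].
  - by rewrite (tmapD psil).
  - by rewrite tswapD TD tswapD.
  - by rewrite (tmapE psil) // tswapE /T (tmapE idE psil) tswapE.
have Tbij : bijective T.
  exists (fun z => galois_lift psi (@id (over_base A)) inv (galois_map z)) => z.
    exact: galTK.
  by apply: (bij_inj galE); rewrite TK.
apply: (eq_bij _ (fun z => esym (uT z))).
exact: (bij_comp (Bijective (@tswapK _ _ _) (@tswapK _ _ _))
          (bij_comp Tbij (Bijective (@tswapK _ _ _) (@tswapK _ _ _)))).
Qed.
End BundleIso.

Section Push.
Variables (k : fieldType) (H : hopfAlgType k) (C C' : comAlgType k).
Variables (f : {lrmorphism C -> C'}) (A : bundle H C).
End Push.

(** * Push-forward of bundles *)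

(* L as an R-module; f is an argument only to determine the module structure. *)
Definition restrict (R S : pzRingType) (f : {rmorphism R -> S}) (L : lmodType S) :
  Type := L.

Section Restriction.
Variables (R S : pzRingType) (f : {rmorphism R -> S}) (L : lmodType S).

HB.instance Definition _ := GRing.Zmodule.on (restrict f L).
Definition restrict_scale (r : R) (x : restrict f L) : restrict f L := f r *: (x : L).
Fact restrict_scaleA r s x :
  restrict_scale r (restrict_scale s x) = restrict_scale (r * s) x.
Proof. by rewrite /restrict_scale scalerA rmorphM. Qed.
Fact restrict_scale1 : left_id 1 restrict_scale.
Proof. by move=> x; rewrite /restrict_scale rmorph1 scale1r. Qed.
Fact restrict_scaleDr : right_distributive restrict_scale +%R.
Proof. by move=> r x y; rewrite /restrict_scale scalerDr. Qed.
Fact restrict_scaleDl x : {morph restrict_scale^~ x : r s / r + s}.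
Proof. by move=> r s; rewrite /restrict_scale rmorphD scalerDl. Qed.
HB.instance Definition _ := GRing.Zmodule_isLmodule.Build R (restrict f L)
  restrict_scaleA restrict_scale1 restrict_scaleDr restrict_scaleDl.
End Restriction.

Section PushBundle.
Variables (k : fieldType) (H : hopfAlgType k) (C C' : comAlgType k).
Variables (f : {lrmorphism C -> C'}) (A : bundle H C).

Local Notation E := (push f A).

Fact push_unit_monoid : monoid_morphism (push_pure f 1 : A -> E).
Proof. by split=> // a b; rewrite push_pureM mulr1. Qed.

Definition push_unit : {lrmorphism A -> E} :=
  mk_lrmorphism (push_pure_linear f 1 : linear (push_pure f 1 : A -> E))
    push_unit_monoid.

Lemma push_unitP : over_morph f push_unit.
Proof.
split=> [c|a]; last exact: push_coactE.
by rewrite -[ext_base A c]mulr1 [LHS]push_pureB mulr1.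
Qed.

Lemma push_pureE c a :
  push_pure f c a = c *: (push_unit a : over_base E) :> over_base E.
Proof. by rewrite over_baseZ [RHS]push_pureM mulr1 mul1r. Qed.

Lemma push_unitZ (c : C) (a : over_base A) :
  push_unit (c *: a) = f c *: (push_unit a : over_base E) :> over_base E.
Proof. by rewrite -push_pureE [LHS]push_pureB mulr1. Qed.

Lemma push_galois : bijective (@galois_map _ _ _ E).
Proof.
have [_ _ [inv galK invK] _] := bundleP A.
pose K := galois_lift push_unit (push_unit : over_base A -> over_base E) inv.
have uD : {morph (push_unit : over_base A -> over_base E) : x y / x + y}.
  exact: (rmorphD push_unit).
have KD : {morph K : x y / x + y}.
  by apply: (galois_liftD push_unitP uD push_unitZ).
exists K => [|w].
- apply: (tens_ext (f := fun z => K (galois_map z)) (g := id)) => // [x y|e x].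
    by rewrite galois_mapD KD.
  elim/push_ind: x => [|x y IHx IHy|c a].
  + by rewrite pure0r (morphD0 (@galois_mapD _ _ _ E)) (morphD0 KD).
  + by rewrite pureDr galois_mapD KD IHx IHy -pureDr.
  (* The scalar c moves across the tensor sign into the left factor, leaving an element of A on the
     right, where [galois_lift_coact] applies. *)
  + rewrite push_pureE -pureZ galois_mapE.
    exact: (galois_lift_coact push_unitP uD push_unitZ galK invK).
- have := @galois_liftK _ _ _ _ _ _ _ _ push_unitP _ _ uD push_unitZ _ galK invK id w.
  rewrite -/K.
  by rewrite tmap_id; apply.
Qed.

(* L ⊗_C' (C' ⊗_C A) ≅ L ⊗_C A, so flatness over C' of the push-forward is
   flatness of A over C tested on C'-modules. *)
Section Restrict.
Variable L : lmodType C'.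

Definition push_restrict : L ⊗ over_base E -> restrict f L ⊗ over_base A :=
  tlift (fun l (x : over_base E) =>
    tlift (fun (c : along f) (a : over_base A) => (c *: l : restrict f L) ⊗ a) x).

Definition restrict_push : restrict f L ⊗ over_base A -> L ⊗ over_base E :=
  tlift (fun (l : restrict f L) (a : over_base A) =>
    (l : L) ⊗ (push_unit a : over_base E)).

Lemma restrict_push_bal : balanced (fun (l : restrict f L) (a : over_base A) =>
    (l : L) ⊗ (push_unit a : over_base E)).
Proof.
split=> [l l' a|l a a'|c l a].
- exact: (pureDl (M := L)).
- by rewrite rmorphD pureDr.
- by rewrite [in RHS]push_unitZ -pureZ.
Qed.

Lemma push_restrict_bal1 (l : L) : balanced (fun (c : along f) (a : over_base A) =>
   (c *: l : restrict f L) ⊗ a).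
Proof.
split=> [c c' a|c a a'|r c a].
- by rewrite scalerDl; apply: (pureDl (M := restrict f L)).
- exact: pureDr.
- by rewrite -pureZ; congr (_ ⊗ _); rewrite -scalerA.
Qed.

Lemma push_restrict_bal : balanced (fun l (x : over_base E) =>
    tlift (fun (c : along f) (a : over_base A) => (c *: l : restrict f L) ⊗ a) x).
Proof.
split=> [l l' x|l x x'|d l x].
- apply: (tlift_morphD (phi := fun l (c : along f) (a : over_base A) =>
            (c *: l : restrict f L) ⊗ a) x push_restrict_bal1).
  by move=> c a p q; rewrite scalerDr; apply: (pureDl (M := restrict f L)).
- exact: (tliftD x x' (push_restrict_bal1 l)).
- have D l' := fun x y => tliftD x y (push_restrict_bal1 l').
  have Z l' := tlift0 (push_restrict_bal1 l').
  elim/push_ind: x => [|x y IHx IHy|c a].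
  + by rewrite scaler0 !Z.
  + by rewrite scalerDr !D IHx IHy.
  + rewrite over_baseZ [X in _ = tlift _ X]push_pureM mul1r.
    rewrite (tliftE _ _ (push_restrict_bal1 _)) [RHS](tliftE _ _ (push_restrict_bal1 _)).
    by rewrite scalerA mulrC.
Qed.

Lemma push_restrictD : {morph push_restrict : x y / x + y}.
Proof. by move=> x y; apply: (tliftD x y push_restrict_bal). Qed.
Lemma restrict_pushD : {morph restrict_push : x y / x + y}.
Proof. by move=> x y; apply: (tliftD x y restrict_push_bal). Qed.
Lemma push_restrictE l c a :
  push_restrict (l ⊗ (push_pure f c a : over_base E)) =
  (c *: l : restrict f L) ⊗ (a : over_base A).
Proof.
by rewrite [LHS](tliftE _ _ push_restrict_bal) [LHS](tliftE _ _ (push_restrict_bal1 _)).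
Qed.
Lemma restrict_pushE (l : restrict f L) (a : over_base A) :
  restrict_push (l ⊗ a) = (l : L) ⊗ (push_unit a : over_base E).
Proof. exact: (tliftE _ _ restrict_push_bal). Qed.

Lemma push_restrictK : cancel push_restrict restrict_push.
Proof.
apply: (tens_ext (f := fun z => restrict_push (push_restrict z)) (g := id)) => // [x y|l x].
  by rewrite push_restrictD restrict_pushD.
elim/push_ind: x => [|x y IHx IHy|c a].
- by rewrite pure0r (morphD0 push_restrictD) (morphD0 restrict_pushD).
- by rewrite pureDr push_restrictD restrict_pushD IHx IHy.
- by rewrite push_restrictE restrict_pushE push_pureE -pureZ.
Qed.

Lemma restrict_pushK : cancel restrict_push push_restrict.
Proof.
apply: (tens_ext (f := fun z => push_restrict (restrict_push z)) (g := id)) => // [x y|l a].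
  by rewrite restrict_pushD push_restrictD.
by rewrite restrict_pushE push_restrictE scale1r.
Qed.
End Restrict.

Lemma restrict_linear (X Y : lmodType C') (w : {linear X -> Y}) :
  linear (w : restrict f X -> restrict f Y).
Proof. by move=> c x y; rewrite [LHS]linearP. Qed.

Lemma push_restrict_nat (X Y : lmodType C') (w : {linear X -> Y}) z :
  tmap (mk_linear (restrict_linear w)) id (push_restrict z) = push_restrict (tmap w id z).
Proof.
have rl := restrict_linear w; have wl : linear w := linearP w.
apply: (tens_ext (f := fun z => tmap (mk_linear rl) id (push_restrict z))
  (g := fun z => push_restrict (tmap w id z))) z => [x y|x y|l x].
- by rewrite push_restrictD tmapD.
- by rewrite tmapD // push_restrictD.
- rewrite tmapE //; elim/push_ind: x => [|x y IHx IHy|c a].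
  + by rewrite !pure0r !(morphD0 (@push_restrictD _)) tmap0.
  + by rewrite !pureDr !push_restrictD tmapD // IHx IHy.
  + by rewrite !push_restrictE tmapE // mk_linearE linearZ.
Qed.

Lemma push_ff : faithfully_flat (over_base E).
Proof.
have [_ _ _ ffA] := bundleP A.
move=> L M N u v.
(* Exactness does not depend on the scalars, so it may be tested over C, where A is faithfully
   flat. *)
transitivity (exact_at (mk_linear (restrict_linear u)) (mk_linear (restrict_linear v))).
  by [].
rewrite ffA; apply: iff_sym.
have bij X : bijective (@push_restrict X) := Bijective (@push_restrictK X) (@restrict_pushK X).
apply: (exact_at_transport (bij L) (bij M) (bij_inj (bij N))).
- exact: (morphD0 (@push_restrictD N)).
- exact: push_restrict_nat.
- exact: push_restrict_nat.
Qed.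

Definition push_bundle : bundle H C' :=
  Bundle (galois_ff_bundle push_ff push_galois).
End PushBundle.

(** * Universal property of the push-forward *)

Section Universal.
Variables (k : fieldType) (H : hopfAlgType k).

Lemma ext_over_push (C C' : comAlgType k) (f : {lrmorphism C -> C'}) (A : bundle H C) :
  ext_over f A (push f A).
Proof. by exists (push_unit f A); apply: push_unitP. Qed.

Lemma ext_iso_over (C : comAlgType k) (A E : centralExt H C) :
  ext_iso A E -> ext_over id A E.
Proof. by case=> phi [_ phib phic]; exists phi. Qed.

Lemma ext_over_iso (C : comAlgType k) (A E : bundle H C) :
  ext_over id A E -> ext_iso A E.
Proof.
by case=> psi psiP; exists psi; split; [apply: bundle_morph_bij| apply psiP..].
Qed.

Section Factor.
Variables (C C' C'' : comAlgType k) (f : {lrmorphism C -> C'}).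
Variables (g : {lrmorphism C' -> C''}) (A : bundle H C) (E : centralExt H C'').
Variables (psi : {lrmorphism A -> E}) (psiP : over_morph (g \o f) psi).

Let phi (c : along f) (a : over_base A) : E := ext_base E (g c) * psi (a : A).
Let phi_bal : balanced phi.
Proof.
split=> [c d a|c a b|r c a]; rewrite /phi.
- by rewrite !rmorphD mulrDl.
- by rewrite rmorphD mulrDr.
- have -> : psi (r *: a) = ext_base E (g (f r)) * psi a.
    by rewrite -[g (f r)]/((g \o f) r) -psiP.1 -rmorphM.
  by rewrite -[r *: c]/(f r * c) !rmorphM mulrA -rmorphM mulrC rmorphM.
Qed.

Let ext (x : push f A) : E := tlift phi x.
Let extE c a : ext (push_pure f c a) = ext_base E (g c) * psi a.
Proof. exact: tliftE phi_bal. Qed.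
Let extD : {morph ext : x y / x + y}.
Proof. by move=> x y; apply: tliftD. Qed.

Let ext_lin : linear ext.
Proof.
move=> r x y; rewrite extD; congr (_ + _).
elim/push_ind: x => [|x x' IHx IHy|c a].
- by rewrite scaler0 (morphD0 extD) scaler0.
- by rewrite scalerDr !extD scalerDr IHx IHy.
- by rewrite push_pureZ !extE !linearZ scalerAl.
Qed.

Let ext_monoid : monoid_morphism ext.
Proof.
split=> [|x y]; first by rewrite [LHS]extE !rmorph1 mulr1.
elim/push_ind: x => [|x x' IHx IHy|c a].
- by rewrite mul0r (morphD0 extD) mul0r.
- by rewrite mulrDl !extD mulrDl IHx IHy.
elim/push_ind: y => [|y y' IHx IHy|d b].
- by rewrite mulr0 (morphD0 extD) mulr0.
- by rewrite mulrDr !extD mulrDr IHx IHy.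
- rewrite [X in ext X]push_pureM !extE !rmorphM.
  by rewrite -!mulrA; congr (_ * _); rewrite !mulrA ext_central.
Qed.

(** The morphism is c ⊗ a |-> g(c) ψ(a): multiplicative because the base of E is central, colinear
    because it is coinvariant. *)
Lemma push_factor : ext_over g (push f A) E.
Proof.
exists (mk_lrmorphism ext_lin ext_monoid); split=> [c|x]; rewrite mk_lrmorphismE.
  by rewrite [LHS]extE rmorph1 mulr1.
elim/push_ind: x => [|x y IHx IHy|c a].
- by rewrite (morphD0 extD) !(morphD0 (linD (@coact_linear _ _ _))) tmap0.
- by rewrite extD !(linD (@coact_linear _ _ _)) tmapD // IHx IHy.
have -> : coact (push_pure f c a : push f A) = tmap (push_pure f c) id (coact a).
  exact: push_coactE.
rewrite extE (coact_monoid E).2 ext_coinv psiP.2.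
elim/tens_ind: (coact a) => [|x y IHx IHy|x y].
- rewrite !tmap0 ?mulr0 //; try exact: push_pure_linear; exact: linearP.
- rewrite !tmapD ?mulrDr ?IHx ?IHy //; try exact: push_pure_linear; exact: linearP.
- rewrite !tmapE //; try exact: push_pure_linear; try exact: linearP.
  by rewrite pureM mul1r -extE.
Qed.
End Factor.

Lemma push_ext_over (C C' C'' : comAlgType k) (f : {lrmorphism C -> C'})
    (g : {lrmorphism C' -> C''}) h (A : bundle H C) (E : centralExt H C'') :
  h =1 g \o f -> ext_over h A E -> ext_over g (push f A) E.
Proof.
move=> hE [psi [psib psic]]; apply: (@push_factor _ _ _ f g A E psi).
by split=> // c; rewrite psib hE.
Qed.
End Universal.

(** * Finite étale base change *)

Section DualBasis.
Variables (R : comNzRingType) (P : lmodType R).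

(** Finite projectivity as explicit data, which base change can carry along. *)
Definition dual_basis (n : nat) (e : 'I_n -> P) (phi : 'I_n -> P -> R^o) : Prop :=
  (forall j, linear (phi j)) /\ (forall x, x = \sum_(j < n) phi j x *: e j).

Lemma projective_dual_basis : finitely_generated P -> projective P ->
  exists n e phi, @dual_basis n e phi.
Proof.
move=> [n [e eP]] prP.
pose g (c : {ffun 'I_n -> R^o}) : P := \sum_(j < n) c j *: e j.
have gl : linear g.
  move=> a x y; rewrite /g scaler_sumr -big_split; apply: eq_bigr => j _ /=.
  by rewrite !ffunE scalerDl -scalerA.
(* The generators give a surjection R^n -> P; projectivity splits it, and the coordinates of the
   section are the dual forms. *)
have [y|l lP] := prP _ _ (mk_linear gl) idfun.
  have [c ->] := eP y; exists [ffun j => c j]; rewrite mk_linearE.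
  by apply: eq_bigr => j _; rewrite ffunE.
exists n, e, (fun j x => l x j); split=> [j a x y|x]; first by rewrite linearP !ffunE.
by rewrite -[LHS]lP.
Qed.

Lemma dual_basis_fg n e phi : @dual_basis n e phi -> finitely_generated P.
Proof. by case=> _ eP; exists n, e => x; exists (phi^~ x). Qed.

Lemma dual_basis_projective n e phi : @dual_basis n e phi -> projective P.
Proof.
case=> phil eP M N g h gS.
have [m mP] := choice (fun j => gS (h (e j))).
pose l x := \sum_(j < n) phi j x *: m j.
have ll : linear l.
  move=> a x y; rewrite /l scaler_sumr -big_split; apply: eq_bigr => j _ /=.
  by rewrite phil scalerDl -scalerA.
exists (mk_linear ll) => x; rewrite mk_linearE [in RHS](eP x) !linear_sum.
by apply: eq_bigr => j _; rewrite !linearZ /= mP.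
Qed.
End DualBasis.

Section SeparabilityIdempotent.
Variables (R : comPzRingType) (B : comAlgType R).

(** Idempotency follows: the second condition gives z e = ([env_mul z] ⊗ 1) e for every z, and z = e
    yields e e = e. *)
Definition separability_idempotent (e : B ⊗ B) : Prop :=
  env_mul e = 1 /\ forall b : B, (b ⊗ 1) * e = (1 ⊗ b) * e.

(** Projectivity gives a B ⊗ B-linear section of the multiplication, and e is its value at 1. *)
Lemma separable_idempotent : separable B -> exists e, separability_idempotent e.
Proof.
move=> prB.
have ml : linear (@env_mul R B : (tensor B B)^o -> along (@env_mul R B)).
  by move=> z x y; rewrite env_mulD [z *: x]/(z * x) env_mulM.
have [y|l lP] := prB _ _ (mk_linear ml) idfun.
  by exists (y ⊗ 1); rewrite [LHS]env_mulE mulr1.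
exists (l 1); split=> [|b]; first exact: lP.
have Z z : z * l 1 = l (env_mul z).
  by rewrite -[z * _](linearZ_LR l z 1); congr (l _); apply: mulr1.
by rewrite !Z !env_mulE mulr1 mul1r.
Qed.

(** For a preimage m of h(1), the lift is x |-> (x ⊗ 1) e m. It is B ⊗ B-linear since z acts on e
    through its product, which is [zE]. *)
Lemma idempotent_separable e : separability_idempotent e -> separable B.
Proof.
move=> [e1 eC] M N g h gS.
have zE z : z * e = (env_mul z ⊗ 1) * e.
  elim/tens_ind: z => [|x y IHx IHy|x y].
  - by rewrite env_mul0 pure0 !mul0r.
  - by rewrite mulrDl IHx IHy env_mulD pureDl mulrDl.
  - rewrite env_mulE -[x ⊗ y]/(x ⊗ y : tensor B B).
    have -> : x ⊗ y = (x ⊗ 1) * (1 ⊗ y) by rewrite pureM mulr1 mul1r.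
    by rewrite -mulrA -eC mulrA pureM mulr1.
have [m mP] := gS (h 1).
pose l (x : along (@env_mul R B)) : M := ((x : B) ⊗ 1 * e) *: m.
have ll : linear l.
  move=> z x y; rewrite /l [z *: x]/(env_mul z * x) pureDl mulrDl scalerDl.
  congr (_ + _); rewrite scalerA [in RHS]mulrA [in RHS]zE; congr ((_ * _) *: _).
  by rewrite env_mulM env_mulE mulr1.
exists (mk_linear ll) => x; rewrite mk_linearE.
rewrite linearZ /= mP -linearZ; congr (h _).
transitivity (env_mul ((x : B) ⊗ 1 * e)); first exact: mulr1.
by rewrite env_mulM e1 env_mulE !mulr1.
Qed.
End SeparabilityIdempotent.

Section IdempotentBaseChange.
Variables (R R' : comPzRingType) (B : comAlgType R) (B' : comAlgType R').
Variables (g : R -> R') (s : B -> B').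
Hypotheses (sD : {morph s : x y / x + y}) (sM : monoid_morphism s).
Hypothesis sZ : forall r b, s (r *: b) = g r *: s b.
Hypothesis gen : forall P : B' -> Prop, P 0 ->
  (forall x y, P x -> P y -> P (x + y)) -> (forall c b, P (c *: s b)) -> forall x, P x.

Let S : B ⊗ B -> B' ⊗ B' := tlift (fun x y => s x ⊗ s y).
Let S_bal : balanced (fun x y => s x ⊗ s y).
Proof.
split=> [x x' y|x y y'|r x y]; first by rewrite sD pureDl.
- by rewrite sD pureDr.
- by rewrite !sZ pureZ.
Qed.
Let SE x y : S (x ⊗ y) = s x ⊗ s y.
Proof. exact: tliftE S_bal. Qed.
Let SD : {morph S : x y / x + y}.
Proof. by move=> x y; apply: tliftD S_bal. Qed.
Let SM : {morph S : x y / x * y}.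
Proof.
move=> x y; elim/tens_ind: x => [|x x' IHx IHy|a b].
- by rewrite mul0r (morphD0 SD) mul0r.
- by rewrite mulrDl !SD mulrDl IHx IHy.
elim/tens_ind: y => [|y y' IHx IHy|a' b'].
- by rewrite mulr0 (morphD0 SD) mulr0.
- by rewrite mulrDr !SD mulrDr IHx IHy.
- by rewrite pureM !SE [RHS]pureM !sM.2.
Qed.

(** The image of e under s ⊗ s works. By [gen], s(B) spans B' over R', so commutation need only be
    checked against elements s(b), where it is the image of the identity for b. *)
Lemma idempotent_base_change :
  (exists e, @separability_idempotent R B e) ->
  exists e, @separability_idempotent R' B' e.
Proof.
move=> [e [e1 eC]]; exists (S e); split.
- have -> : env_mul (S e) = s (env_mul e).
    elim/tens_ind: (e) => [|x y IHx IHy|x y].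
    + by rewrite (morphD0 SD) !env_mul0 (morphD0 sD).
    + by rewrite SD !env_mulD sD IHx IHy.
    + by rewrite SE !env_mulE sM.2.
  by rewrite e1 sM.1.
- apply: gen => [|x y IHx IHy|c b].
  + by rewrite pure0 pure0r !mul0r.
  + by rewrite pureDl pureDr !mulrDl IHx IHy.
  + rewrite -pureZl -pureZr -!tens_scaleAl; congr (_ *: _).
    have <- : S (b ⊗ 1) = s b ⊗ 1 by rewrite SE sM.1.
    have <- : S (1 ⊗ b) = 1 ⊗ s b by rewrite SE sM.1.
    by rewrite -!SM eC.
Qed.
End IdempotentBaseChange.

(* The push-out C' ⊗_C D as a k-algebra; the proof nz is needed because library
   algebras are nonzero. *)
Definition cobase (k : fieldType) (C C' D : comAlgType k) (f : {lrmorphism C -> C'})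
    (i : {lrmorphism C -> D}) (nz : (1 : tensor (along f) (along i)) != 0) : Type :=
  along f ⊗ along i.

Section Cobase.
Variables (k : fieldType) (C C' D : comAlgType k).
Variables (f : {lrmorphism C -> C'}) (i : {lrmorphism C -> D}).
Variable nz : (1 : tensor (along f) (along i)) != 0.

Local Notation DD := (cobase nz).
HB.instance Definition _ := GRing.PzRing.on DD.
HB.instance Definition _ := GRing.PzSemiRing_isNonZero.Build DD nz.

Definition cobase_pure (c : C') (d : D) : DD := (c : along f) ⊗ (d : along i).

Lemma cobase_pureM c d c' d' :
  cobase_pure c d * cobase_pure c' d' = cobase_pure (c * c') (d * d').
Proof. exact: (@pureM _ (along f) (along i)). Qed.
Lemma cobase_pureDl c c' d : cobase_pure (c + c') d = cobase_pure c d + cobase_pure c' d.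
Proof. exact: (@pureDl _ (along f)). Qed.
Lemma cobase_pureDr c d d' : cobase_pure c (d + d') = cobase_pure c d + cobase_pure c d'.
Proof. exact: (@pureDr _ (along f) (along i)). Qed.
Lemma cobase_pureB c r d : cobase_pure c (i r * d) = cobase_pure (f r * c) d.
Proof. exact/esym/(@pureZ _ (along f) (along i)). Qed.

Lemma cobase_ind (P : DD -> Prop) :
  P 0 -> (forall x y, P x -> P y -> P (x + y)) ->
  (forall c d, P (cobase_pure c d)) -> forall x, P x.
Proof. exact: (@tens_ind _ (along f) (along i)). Qed.

Fact cobase_mulC : commutative (@GRing.mul DD).
Proof.
move=> x y; elim/cobase_ind: x => [|x x' IHx IHy|c d].
- by rewrite mul0r mulr0.
- by rewrite mulrDl mulrDr IHx IHy.
elim/cobase_ind: y => [|y y' IHx IHy|c' d'].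
- by rewrite mul0r mulr0.
- by rewrite mulrDl mulrDr IHx IHy.
- by rewrite !cobase_pureM mulrC (mulrC d).
Qed.
HB.instance Definition _ := GRing.PzSemiRing_hasCommutativeMul.Build DD cobase_mulC.

Definition cobase_scale (a : k) (x : DD) : DD := cobase_pure a%:A 1 * x.
Fact cobase_scaleA a b x : cobase_scale a (cobase_scale b x) = cobase_scale (a * b) x.
Proof. by rewrite /cobase_scale mulrA cobase_pureM mulr1 -scalerAl mul1r scalerA. Qed.
Fact cobase_scale1 : left_id 1 cobase_scale.
Proof. by move=> x; rewrite /cobase_scale scale1r; apply: mul1r. Qed.
Fact cobase_scaleDr : right_distributive cobase_scale +%R.
Proof. by move=> a x y; rewrite /cobase_scale mulrDr. Qed.
Fact cobase_scaleDl x : {morph cobase_scale^~ x : a b / a + b}.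
Proof. by move=> a b; rewrite /cobase_scale scalerDl cobase_pureDl mulrDl. Qed.
HB.instance Definition _ := GRing.Zmodule_isLmodule.Build k DD
  cobase_scaleA cobase_scale1 cobase_scaleDr cobase_scaleDl.
Fact cobase_scaleAl (a : k) (x y : DD) : a *: (x * y) = (a *: x) * y.
Proof. exact: mulrA. Qed.
HB.instance Definition _ :=
  GRing.LSemiModule_isLSemiAlgebra.Build k DD cobase_scaleAl.
HB.instance Definition _ := GRing.LSemiAlgebra_isComSemiAlgebra.Build k DD.

Definition cobase_inl (c : C') : DD := cobase_pure c 1.
Definition cobase_inr (d : D) : DD := cobase_pure 1 d.

Fact cobase_inl_linear : linear cobase_inl.
Proof.
move=> a c c'; rewrite /cobase_inl cobase_pureDl; congr (_ + _).
by rewrite [RHS]cobase_pureM mulr1 mulr_algl.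
Qed.
Fact cobase_inl_monoid : monoid_morphism cobase_inl.
Proof. by split=> // c c'; rewrite cobase_pureM mulr1. Qed.
Fact cobase_inr_linear : linear cobase_inr.
Proof.
move=> a d d'; rewrite /cobase_inr cobase_pureDr; congr (_ + _).
by rewrite [RHS]cobase_pureM mul1r -(rmorph_alg f) -cobase_pureB rmorph_alg mulr_algl.
Qed.
Fact cobase_inr_monoid : monoid_morphism cobase_inr.
Proof. by split=> // d d'; rewrite cobase_pureM mulr1. Qed.

Definition cobase_left : {lrmorphism C' -> DD} :=
  mk_lrmorphism cobase_inl_linear cobase_inl_monoid.
Definition cobase_right : {lrmorphism D -> DD} :=
  mk_lrmorphism cobase_inr_linear cobase_inr_monoid.

Lemma cobase_square c : cobase_right (i c) = cobase_left (f c).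
Proof. by have := cobase_pureB 1 c 1; rewrite !mulr1. Qed.

Local Notation DL := (along cobase_left).

Lemma along_leftZ (c : C') (x : DL) : c *: x = (cobase_left c * x : DD).
Proof. by []. Qed.

Lemma cobase_pureE c d : cobase_pure c d = c *: (cobase_right d : DL) :> DL.
Proof. by rewrite along_leftZ [RHS]cobase_pureM mulr1 mul1r. Qed.

Lemma cobase_rightZ r (d : along i) :
  cobase_right (r *: d) = f r *: (cobase_right d : DL) :> DL.
Proof. by rewrite along_leftZ -cobase_square -rmorphM. Qed.

Section DualBasis.
Variables (n : nat) (e : 'I_n -> along i) (phi : 'I_n -> along i -> C^o).
Hypothesis (dbP : dual_basis e phi).

Let psi j (c : along f) (d : along i) : C' := c * f (phi j d).
Let psi_bal j : balanced (psi j).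
Proof.
have [lin _] := dbP.
split=> [c c' d|c d d'|r c d]; rewrite /psi ?mulrDl // -?mulrDr.
- by rewrite (linD (lin j)) rmorphD.
- by rewrite (linZ (lin j)) rmorphM mulrCA mulrA.
Qed.
Let coordp j (x : DL) : C'^o := tlift (psi j) x.
Let coordpE j c d : coordp j (cobase_pure c d) = c * f (phi j d).
Proof. exact: tliftE (psi_bal j). Qed.

(** The new coordinates are c ⊗ d |-> c f(φ_j(d)), the extensions of scalars of the old ones. *)
Lemma cobase_dual_basis :
  dual_basis (fun j => cobase_right (e j) : DL) coordp.
Proof.
have coD j : {morph coordp j : x y / x + y}.
  by move=> x y; apply: tliftD (psi_bal j).
split=> [j a x y|x].
- rewrite coD; congr (_ + _).
  elim/cobase_ind: x => [|x x' IHx IHy|c d].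
  + by rewrite scaler0 (morphD0 (coD j)) scaler0.
  + by rewrite scalerDr !coD scalerDr IHx IHy.
  + rewrite along_leftZ [X in coordp j X]cobase_pureM mul1r !coordpE -mulrA //.
elim/cobase_ind: x => [|x y IHx IHy|c d].
- by rewrite big1 // => j _; rewrite (morphD0 (coD j)) scale0r.
- rewrite [LHS](congr2 +%R IHx IHy) -big_split; apply: eq_bigr => j _.
  by rewrite coD scalerDl.
rewrite [in LHS](dbP.2 d) cobase_pureE
  [cobase_right _](linear_sum cobase_right) scaler_sumr.
by apply: eq_bigr => j _; rewrite coordpE -scalerA -cobase_rightZ.
Qed.
End DualBasis.

Lemma cobase_idempotent :
  (exists e, @separability_idempotent C (along i) e) ->
  exists e, @separability_idempotent C' DL e.
Proof.
apply: (idempotent_base_change (g := f) (s := cobase_right : along i -> DL)).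
- exact: rmorphD cobase_right.
- by split; [apply: rmorph1 | apply: rmorphM cobase_right].
- exact: cobase_rightZ.
- move=> P P0 PD PZ x; elim/cobase_ind: x => // c d.
  by rewrite cobase_pureE; apply: PZ.
Qed.

Lemma cobase_finite_etale : finite_etale i -> finite_etale cobase_left.
Proof.
move=> [fg pr /separable_idempotent/cobase_idempotent[e eP]].
have [n [b [phi /cobase_dual_basis bP]]] := projective_dual_basis fg pr.
split; [exact: dual_basis_fg bP|exact: dual_basis_projective bP|].
exact: idempotent_separable eP.
Qed.
End Cobase.

(** * Morphisms between polynomial algebras *)

Section KPoly.
Variables (k : fieldType) (D D' : comAlgType k) (g : {lrmorphism D -> D'}).

Definition kpoly_map (p : kpoly D) : kpoly D' := map_poly g (p : {poly D}).
Fact kpoly_map_linear : linear kpoly_map.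
Proof.
move=> a p q; rewrite /kpoly_map rmorphD; congr (_ + _).
by rewrite [LHS]map_polyZ /= rmorph_alg.
Qed.
Fact kpoly_map_monoid : monoid_morphism kpoly_map.
Proof. by split=> [|p q]; rewrite /kpoly_map ?rmorph1 ?rmorphM. Qed.
Definition kpoly_map_morph : {lrmorphism kpoly D -> kpoly D'} :=
  mk_lrmorphism kpoly_map_linear kpoly_map_monoid.

Lemma ev_kpoly_map c p : ev (g c) (kpoly_map_morph p) = g (ev c p).
Proof. exact: horner_map. Qed.
End KPoly.

Section KPolyC.
Variables (k : fieldType) (C : comAlgType k).
Definition kpolyC (c : C) : kpoly C := c%:P.
Fact kpolyC_linear : linear kpolyC.
Proof.
by move=> a c d; rewrite /kpolyC polyCD -[a *: c]mulr_algl polyCM mul_polyC.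
Qed.
Fact kpolyC_monoid : monoid_morphism kpolyC.
Proof. by split=> // c d; apply: polyCM. Qed.
Definition kpolyC_morph : {lrmorphism C -> kpoly C} :=
  mk_lrmorphism kpolyC_linear kpolyC_monoid.
Lemma ev_kpolyC x c : ev x (kpolyC_morph c) = c.
Proof. exact: hornerC. Qed.
End KPolyC.

Lemma finite_etale_id (C : comNzRingType) : finite_etale (idfun : {rmorphism C -> C}).
Proof.
pose B := along (idfun : {rmorphism C -> C}).
pose e (j : 'I_1) : B := 1.
pose phi (j : 'I_1) (x : B) : C^o := x.
have db : dual_basis e phi by split=> // x; rewrite big_ord1; apply/esym/mulr1.
split; [exact: dual_basis_fg db|exact: dual_basis_projective db|].
apply: (@idempotent_separable C B (1 ⊗ 1)); split.
  by rewrite env_mulE mulr1.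
move=> b; have -> : b = b *: (1 : B) by apply/esym/mulr1.
by rewrite pureZ.
Qed.

(** * Nonzero push-outs of finite étale extensions *)

Definition nonvanishing (k : fieldType) (C C' : comAlgType k)
    (f : {lrmorphism C -> C'}) : Prop :=
  forall (D : comAlgType k) (i : {lrmorphism C -> D}),
    finite_etale i -> (1 : tensor (along f) (along i)) != 0.

Section Nonvanishing.
Variables (k : fieldType) (C C' : comAlgType k) (f : {lrmorphism C -> C'}).

(** The retraction induces c ⊗ d |-> i(p(c)) d from C' ⊗ D to D, which sends 1 to 1, and D is
    nonzero. *)
Lemma nonvanishing_retract (p : {lrmorphism C' -> C}) : p \o f =1 id -> nonvanishing f.
Proof.
move=> pf D i _; apply/eqP => e10.
pose phi (c : along f) (d : along i) : D := i (p c) * d.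
have bal : balanced phi.
  split=> [c c' d|c d d'|r c d]; rewrite /phi.
  - by rewrite !rmorphD mulrDl.
  - by rewrite mulrDr.
  - have -> : p (r *: c) = r * p c by rewrite [LHS]rmorphM; congr (_ * _); apply: pf.
    by rewrite rmorphM mulrAC mulrC -[r *: d]/(i r * d).
have := tliftE 1 1 bal; rewrite -[_ ⊗ _]/(1 : tensor (along f) (along i)) e10 tlift0 //.
by rewrite /phi !rmorph1 mulr1 => /eqP; rewrite eq_sym oner_eq0.
Qed.

Variable gr : {rmorphism C -> {poly C}}.
Hypotheses (gr1 : forall c, (gr c).[1] = c) (gr0 : forall c, f c = 0 -> (gr c)`_0 = 0).

Lemma nonvanishing_graded : nonvanishing f.
Proof.
move=> D i [fg pr _]; apply/eqP => e10.
have t0 (x : tensor (along f) (along i)) : x = 0 by rewrite -[x]mul1r e10 mul0r.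
(* A linear form φ on D extends to C' ⊗ D by c ⊗ d |-> c f(φ(d)); on the zero module this has to
   vanish. *)
have f0 (phi : along i -> C^o) d : linear phi -> f (phi d) = 0.
  move=> lin.
  have bal : balanced (fun (c : along f) (d : along i) => c * f (phi d) : C').
    split=> [c c' x|c x x'|r c x]; rewrite ?mulrDl // -?mulrDr.
    - by rewrite (linD lin) rmorphD.
    - by rewrite (linZ lin) rmorphM mulrCA mulrA.
  by have := tliftE 1 d bal; rewrite [_ ⊗ _]t0 tlift0 // mul1r.
have [n [e [phi [lin eP]]]] := projective_dual_basis fg pr.
(* Values of linear forms have t-order at least m, for every m. The induction runs over all forms at
   once: in ψ(d) = Σ φ_j(d) ψ(e_j) the first factor has order at least m by induction, and the
   second has no constant term by [f0] and [gr0]. *)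
have low m : forall (psi : along i -> C^o) d, linear psi ->
    forall l, (l < m)%N -> (gr (psi d))`_l = 0.
  elim: m => // m IH psi d psil l lm.
  have -> : psi d = \sum_(j < n) phi j d * psi (e j).
    rewrite [in LHS](eP d) -[psi]/(mk_linear psil : _ -> _) linear_sum.
    by apply: eq_bigr => j _; rewrite linearZ.
  rewrite rmorph_sum coef_sum big1 // => j _; rewrite rmorphM coefM big1 // => -[a al] _ /=.
  have [am|ma] := ltnP a m; first by rewrite IH ?mul0r.
  (* Here a <= l <= m <= a, so only the constant coefficient of the second factor is left. *)
  have -> : (l - a = 0)%N.
    by apply/eqP; rewrite subn_eq0 (leq_trans _ ma).
  by rewrite (gr0 (f0 _ _ psil)) mulr0.
have z (psi : along i -> C^o) d : linear psi -> psi d = 0.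
  move=> psil; rewrite -[LHS]gr1; have -> : gr (psi d) = 0; last exact: horner0.
  by apply/polyP => l; rewrite coef0 (low l.+1).
(* With all linear forms zero, the dual basis expansion of 1 is empty, so D would be zero. *)
have : (1 : along i) = 0 by rewrite [LHS]eP big1 // => j _; rewrite z ?scale0r.
by move/eqP; rewrite oner_eq0.
Qed.
End Nonvanishing.

(** * Homotopies *)

Section PushHomotopy.
Variables (k : fieldType) (H : hopfAlgType k).

Lemma ext_over_id (C : comAlgType k) (A : centralExt H C) : ext_over id A A.
Proof.
by exists idfun; split=> // a; apply/esym/(@tmap_id k A H).
Qed.

(** The universal property turns a morphism over f into one over the identity of C', which is
    bijective between bundles. *)
Lemma push_ext_iso (C C' : comAlgType k) (f : {lrmorphism C -> C'})
    (A : bundle H C) (E : bundle H C') :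
  ext_over f A E -> ext_iso (push f A) E.
Proof.
move=> AE; apply: (@ext_over_iso _ _ _ (push_bundle f A)).
exact: (@push_ext_over _ _ _ _ _ f (idfun : {lrmorphism C' -> C'})) AE.
Qed.

(** A homotopy with trivial étale extension, its two ends given by mere morphisms over the
    evaluations. *)
Lemma homotopy_over (C : comAlgType k) (A A' : bundle H C) (B : bundle H (kpoly C)) :
  ext_over (ev 0) B A -> ext_over (ev 1) B A' -> homotopy A A'.
Proof.
pose i : {lrmorphism C -> C} := idfun.
have step c (E : bundle H C) : ext_over (ev c) B E -> ext_iso (push (ev c) B) (push i E).
  move=> BE; apply: (@push_ext_iso _ _ _ _ (push_bundle i E)).
  exact: (ext_over_comp _ BE (ext_over_push i E)).
move=> BA BA'; exists C, i, B; split; [exact: finite_etale_id|exact: step..].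
Qed.

(** The constant homotopy: the push-forward of A along C -> C[t]. *)
Lemma homotopy_iso (C : comAlgType k) (A A' : bundle H C) :
  ext_over id A A' -> homotopy A A'.
Proof.
move=> AA'; apply: (@homotopy_over _ _ _ (push_bundle (kpolyC_morph C) A)).
- apply: (@push_ext_over _ _ _ _ _ (kpolyC_morph C) (ev 0) id).
    by move=> c; rewrite /= ev_kpolyC.
  exact: ext_over_id.
- apply: (@push_ext_over _ _ _ _ _ (kpolyC_morph C) (ev 1) id) => //.
  by move=> c; rewrite /= ev_kpolyC.
Qed.

Section Push.
Variables (C C' : comAlgType k) (f : {lrmorphism C -> C'}).
Hypothesis nzf : nonvanishing f.

Lemma homotopy_push (A A' : bundle H C) :
  homotopy A A' -> homotopy (push_bundle f A) (push_bundle f A').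
Proof.
case=> D [i [B [et h0 h1]]].
pose i' := cobase_left (nzf et); pose g := cobase_right (nzf et).
pose B' := push_bundle (kpoly_map_morph g) B.
(* Both ends are treated at once, for an arbitrary evaluation point c of D; [g] fixes the points 0
   and 1. *)
have step c (E : bundle H C) : ext_iso (push (ev c) B) (push i E) ->
    ext_iso (push (ev (g c)) B') (push i' (push_bundle f E)).
  move=> /ext_iso_over iso.
  apply: (@push_ext_iso _ _ _ _ (push_bundle i' (push_bundle f E))).
  (* It suffices to map B to i'_* f_* E over g [c]. The map is B -> [c]_* B -> i_* E -> i'_* f_* E,
     the last arrow coming from g i = i' f. *)
  apply: (@push_ext_over _ _ _ _ _ (kpoly_map_morph g) (ev (g c)) (g \o ev c)).
    by move=> p; apply/esym/ev_kpoly_map.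
  apply: (@ext_over_comp _ _ _ _ _ (ev c) g _ _ (push i E)) => //.
    exact: (ext_over_comp _ (ext_over_push (ev c) B) iso).
  apply: (@push_ext_over _ _ _ _ _ i g (i' \o f)) => [d|].
    exact/esym/cobase_square.
  exact: (ext_over_comp _ (ext_over_push f E) (ext_over_push i' (push_bundle f E))).
exists (cobase (nzf et)), i', B'; split; first exact: cobase_finite_etale.
- by rewrite -(rmorph0 g); apply: step.
- by rewrite -(rmorph1 g); apply: step.
Qed.
End Push.
End PushHomotopy.

(** * Graded algebras *)

Section HomogenizedGrading.
Variables (k : fieldType) (C : comAlgType k) (G : grading C).

(* The polynomials q with q`_j of degree j form a subalgebra, mapped bijectively
   onto C by evaluation at 1. *)
Definition hpoly (q : {poly C}) : Prop := forall j, q`_j \in G j.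

Lemma homog_linear i a x y : x \in G i -> y \in G i -> a *: x + y \in G i.
Proof. by move=> xG yG; apply: (homog_submod G i).2. Qed.
Lemma homog0_in i : 0 \in G i.
Proof. exact: (homog_submod G i).1. Qed.

Lemma hpoly_linear a p q : hpoly p -> hpoly q -> hpoly (a%:A *: p + q).
Proof.
by move=> hp hq j; rewrite coefD coefZ mulr_algl; apply: homog_linear.
Qed.

Lemma hpolyM p q : hpoly p -> hpoly q -> hpoly (p * q).
Proof.
move=> hp hq j; rewrite coefM; elim/big_ind: _ => [|x y xG yG|i _].
- exact: homog0_in.
- by rewrite -[x]scale1r; apply: homog_linear.
- by rewrite -[X in G X](subnKC (leq_ord i)); apply: homogM.
Qed.

Lemma hpolyC c : c \in G 0%N -> hpoly c%:P.
Proof. by move=> cG [|j]; rewrite coefC //=; apply: homog0_in. Qed.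

Lemma hpoly_exists x : exists q, hpoly q /\ q.[1] = x.
Proof.
have [n [c [cG ->]]] := homog_sum G x; exists (\poly_(j < n) c j); split=> [j|].
  by rewrite coef_poly; case: ifP => // _; apply: homog0_in.
by rewrite horner_poly; apply: eq_bigr => j _; rewrite expr1n mulr1.
Qed.

Lemma hpoly_inj p q : hpoly p -> hpoly q -> p.[1] = q.[1] -> p = q.
Proof.
move=> hp hq e; apply/eqP; rewrite -subr_eq0; apply/eqP.
set r := p - q; have r1 : r.[1] = 0 by rewrite hornerD hornerN e subrr.
have hr j : r`_j \in G j.
  by rewrite coefB addrC -scaleN1r; apply: homog_linear.
have r0 := homog_free hr (n := size r) _.
apply/polyP => j; rewrite coef0; have [jr|rj] := ltnP j (size r).
  apply: r0 => //; rewrite -[RHS]r1 horner_coef; apply: eq_bigr => l _.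
  by rewrite expr1n mulr1.
by rewrite nth_default.
Qed.

Definition homogenize (x : C) : kpoly C := sval (cid (hpoly_exists x)).
Lemma homogenize_hpoly x : hpoly (homogenize x).
Proof. by rewrite /homogenize; case: cid => q []. Qed.
Lemma homogenize1 x : (homogenize x : {poly C}).[1] = x.
Proof. by rewrite /homogenize; case: cid => q []. Qed.

(** [homogenize] is picked by choice; this uniqueness makes it a morphism, as polynomials satisfying
    [hpoly] are closed under the operations and evaluation at 1 respects them. *)
Lemma homogenize_uniq x q : hpoly q -> q.[1] = x -> homogenize x = q.
Proof.
by move=> hq qx; apply: hpoly_inj (homogenize_hpoly x) hq _; rewrite homogenize1.
Qed.

Fact homogenize_linear : linear homogenize.
Proof.
move=> a x y; apply: homogenize_uniq.
- by apply: hpoly_linear; apply: homogenize_hpoly.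
- by rewrite hornerD hornerZ !homogenize1 mulr_algl.
Qed.
Fact homogenize_monoid : monoid_morphism homogenize.
Proof.
split=> [|x y]; apply: homogenize_uniq.
- exact/hpolyC/homog1.
- exact: hornerC.
- by apply: hpolyM; apply: homogenize_hpoly.
- by rewrite hornerM !homogenize1.
Qed.
Definition homogenize_morph : {lrmorphism C -> kpoly C} :=
  mk_lrmorphism homogenize_linear homogenize_monoid.

Definition degree0_proj (x : C) : degree0 G :=
  exist _ (homogenize x : {poly C})`_0 (homogenize_hpoly x 0).

(** The identity ι p = [0] h; as ι is an injective morphism, p inherits linearity and
    multiplicativity from [0] h. *)
Lemma degree0_projE x : degree0_incl (degree0_proj x) = ev 0 (homogenize_morph x).
Proof. by rewrite [RHS]horner_coef0. Qed.

Fact degree0_proj_linear : linear degree0_proj.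
Proof.
move=> a x y; apply: val_inj.
apply: etrans (degree0_projE _) _.
apply: etrans (linearP (@ev k C 0 \o homogenize_morph) a x y) _.
apply: etrans _ (esym (linearP (@degree0_incl k C G) a _ _)).
by congr (_ *: _ + _); apply/esym/degree0_projE.
Qed.
Fact degree0_proj_monoid : monoid_morphism degree0_proj.
Proof.
split=> [|x y]; apply: val_inj.
- by apply: etrans (degree0_projE _) _; apply: (rmorph1 (@ev k C 0 \o homogenize_morph)).
- apply: etrans (degree0_projE _) _.
  apply: etrans (rmorphM (@ev k C 0 \o homogenize_morph) x y) _.
  apply: etrans _ (esym (rmorphM (@degree0_incl k C G) _ _)).
  by congr (_ * _); apply/esym/degree0_projE.
Qed.
Definition degree0_proj_morph : {lrmorphism C -> degree0 G} :=
  mk_lrmorphism degree0_proj_linear degree0_proj_monoid.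

Lemma degree0_inclK : cancel (@degree0_incl k C G) degree0_proj_morph.
Proof.
move=> x; apply: val_inj; rewrite [LHS]degree0_projE.
rewrite [homogenize_morph _](homogenize_uniq (q := (degree0_incl x)%:P)).
- exact: hornerC.
- exact/hpolyC/valP.
- exact: hornerC.
Qed.
End HomogenizedGrading.

(** * Push-forward on homotopy classes and the bijection *)

Section Classes.
Variables (k : fieldType) (H : hopfAlgType k).

Lemma homotopy_class_eq (C : comAlgType k) (A A' : bundle H C) :
  homotopy_equiv A A' -> homotopy_class A = homotopy_class A'.
Proof.
move=> AA'; apply: eq_exist; apply/funext => B; apply/propext; split=> [AB|A'B].
- by apply: rst_trans AB; apply: rst_sym.
- exact: rst_trans A'B.
Qed.

Lemma homotopy_class_inv (C : comAlgType k) (A A' : bundle H C) :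
  homotopy_class A = homotopy_class A' -> homotopy_equiv A A'.
Proof.
by move/(congr1 sval) => /= ->; apply: rst_refl.
Qed.

Section Push.
Variables (C C' : comAlgType k) (f : {lrmorphism C -> C'}).

Definition class_repr (S : homotopy_classes H C) : bundle H C :=
  sval (cid (svalP S)).

Lemma class_reprK S : homotopy_class (class_repr S) = S.
Proof.
rewrite /class_repr; case: cid => A /= e.
by case: S e => S SP /= e; apply: eq_exist.
Qed.

(** Defined on a chosen representative; for nonvanishing f, [push_classE] shows that the choice does
    not matter. *)
Definition push_class (S : homotopy_classes H C) : homotopy_classes H C' :=
  homotopy_class (push_bundle f (class_repr S)).

Hypothesis nzf : nonvanishing f.

Lemma homotopy_equiv_push (A A' : bundle H C) :
  homotopy_equiv A A' -> homotopy_equiv (push_bundle f A) (push_bundle f A').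
Proof.
elim=> {A A'} [A A' AA'|A|A A' _|A A' A'' _ IH _].
- exact/rst_step/homotopy_push.
- exact: rst_refl.
- exact: rst_sym.
- exact: rst_trans.
Qed.

Lemma push_classE A : push_class (homotopy_class A) = homotopy_class (push_bundle f A).
Proof.
exact/homotopy_class_eq/homotopy_equiv_push/homotopy_class_inv/class_reprK.
Qed.
End Push.
End Classes.

Theorem corollary2p4 (k : fieldType) (H : hopfAlgType k) (C : comAlgType k)
    (G : grading C) :
  exists F : homotopy_classes H (degree0 G) -> homotopy_classes H C,
    (forall A : bundle H (degree0 G),
       exists hA : is_bundle (push (@degree0_incl k C G) A),
         F (homotopy_class A) = homotopy_class (Bundle hA)) /\
    bijective F.
Proof.
pose incl : {lrmorphism degree0 G -> C} := @degree0_incl k C G.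
pose proj := degree0_proj_morph G.
have nz_incl : nonvanishing incl by apply: nonvanishing_retract (@degree0_inclK _ _ G).
have nz_proj : nonvanishing proj.
  apply: (@nonvanishing_graded _ _ _ _ (homogenize_morph G)) => [c|c pc0].
    exact: homogenize1.
  have := degree0_projE G c; rewrite [ev 0 _]horner_coef0 => <-.
  by rewrite [degree0_proj _ _]pc0 rmorph0.
exists (push_class (H := H) incl); split=> [A|].
  exists (bundleP (push_bundle incl A)).
  by rewrite push_classE //; congr homotopy_class; case: push_bundle.
exists (push_class (H := H) proj) => S; rewrite -[S]class_reprK !push_classE //.
(* p_* ι_* A ≅ A: two uses of the universal property reduce this to the identity of A, which lies
   over p ι = id. *)
- apply/homotopy_class_eq/rst_step/homotopy_iso.
  apply: (@push_ext_over _ _ _ _ _ proj idfun proj) => //.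
  apply: (@push_ext_over _ _ _ _ _ incl proj id) => [c|].
    exact/esym/degree0_inclK.
  exact: ext_over_id.
- set A := class_repr S.
  apply/homotopy_class_eq/rst_step.
  (* The homotopy is h_* A: its end at 0 is ι_* p_* A because [0] h = ι p, its end at 1 is A because
     [1] h = id. *)
  apply: (@homotopy_over _ _ _ _ _ (push_bundle (homogenize_morph G) A)).
  + apply: (@push_ext_over _ _ _ _ _ (homogenize_morph G) (ev 0) (incl \o proj)) => [c|].
      exact: degree0_projE.
    exact: (ext_over_comp _ (ext_over_push proj A) (ext_over_push incl (push_bundle proj A))).
  + apply: (@push_ext_over _ _ _ _ _ (homogenize_morph G) (ev 1) id) => [c|].
      exact/esym/homogenize1.
    exact: ext_over_id.
Qed.
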